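(* Let $\mu_1$ and $\mu_2$ be two compactly supported Borel probability measures on $\mathbb{R}^2$ that charge no line (every line has measure $0$) and whose supports have non-empty interiors. If $\ell_{\mu_1}=\ell_{\mu_2}$, then there exists a projective transformation $f$ such that $\mu_2\circ f=\mu_1$.
   Context: All point sets are finite subsets of $\mathbb{R}^2$ with no three collinear points. Two such sets $P,Q$ have the same order type if there is a bijection $f:P\to Q$ preserving the orientation (clockwise/counter-clockwise) of every triple of distinct points; an order type is an equivalence class, its size the number of points. For a Borel probability measure $\mu$ on $\mathbb{R}^2$ and an order type $\omega$, $\ell_\mu(\omega)$ is the probability that $|\omega|$ points sampled independently from $\mu$ have order type $\omega$. *)

(* Defs.v *)
(* MathComp / MathComp-Analysis *)
From HB Require Import structures.
From mathcomp Require Import all_boot all_order all_algebra.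
From mathcomp Require Import generic_quotient finmap.
From mathcomp Require Import all_classical all_reals all_analysis.
From mathcomp Require Import measurable_realfun.

Set Implicit Arguments.
Unset Strict Implicit.
Unset Printing Implicit Defensive.
Import Order.TTheory GRing.Theory Num.Theory.
Import numFieldNormedType.Exports.
Local Open Scope classical_set_scope.
Local Open Scope ring_scope.
Local Open Scope quotient_scope.

(* R^2 is R * R with its product sigma-algebra; this is the Borel one. *)
Lemma measurable_plane_borel (R : realType) :
  (@measurable _ (R * R)%type) = <<s (@open (R * R)%type) >>.
Proof.
apply/seteqP; split.
  have [s0 sD sU] := smallest_sigma_algebra [set: R * R] (@open (R * R)%type).
  pose G (f : R * R -> R) := [set A : set R | <<s (@open (R * R)%type) >> (f @^-1` A)].
  have mG (f : R * R -> R) : continuous f -> forall A : set R, measurable A -> G f A.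
    move=> cf; rewrite [X in forall A, X A -> _]RGenOInfty.measurableE.
    apply: smallest_sub => [|_ [x ->]].
      split => [|A' GA'|F GF].
      - by rewrite /G/= preimage_set0.
      - by rewrite /G/= setTD preimage_setC -setTD; exact: sD.
      - by rewrite /G/= preimage_bigcup; exact: sU.
    apply: sub_sigma_algebra; apply: open_comp; last exact: interval_open.
    by move=> y _; exact: cf.
  rewrite measurable_prod_measurableType; apply: smallest_sub.
    exact: smallest_sigma_algebra.
  move=> _ [A mA [B mB <-]].
  have -> : A `*` B = (fst @^-1` A) `&` (snd @^-1` B) by [].
  apply: (@measurableI _ (g_sigma_algebraType (@open (R * R)%type))).
    by apply: (mG fst) => // x; exact: cvg_fst.
  by apply: (mG snd) => // x; exact: cvg_snd.
apply: smallest_sub; first exact: sigma_algebra_measurable.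
move=> U oU.
pose box (q : (rat * rat) * (rat * rat)) : set (R * R) :=
  [set` `]ratr q.1.1, ratr q.1.2[] `*` [set` `]ratr q.2.1, ratr q.2.2[].
have -> : U = \bigcup_(q in [set q | box q `<=` U]) box q.
  apply/seteqP; split=> [[x y] Uxy|]; last by apply: bigcup_sub.
  have : nbhs (x, y) U by exact: open_nbhs_nbhs.
  case=> -[V W] /= [] /nbhs_ballP[e /= e0 Ve] /nbhs_ballP[e' /= e'0 We'] VWU.
  have H (z d : R) : 0 < d -> exists q : rat * rat,
      (z \in `]ratr q.1, ratr q.2[) /\
      [set` `]ratr q.1, ratr q.2[] `<=` ball z d.
    move=> d0.
    have /rat_in_itvoo[p /itvP pE] : z - d < z by rewrite ltrBlDr ltrDl.
    have /rat_in_itvoo[r /itvP rE] : z < z + d by rewrite ltrDl.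
    exists (p, r); split => /=; first by rewrite in_itv/= pE rE.
    move=> t /=; rewrite in_itv/= ball_itv/= in_itv/= => /andP[pt tr].
    by rewrite (lt_trans _ pt) ?pE//= (lt_trans tr) ?rE.
  have [p [xp pV]] := H x e e0; have [r [yr rW]] := H y e' e'0.
  exists (p, r) => //= -[s t] [/= sp tr].
  by apply: VWU; split => /=; [apply/Ve/pV|apply/We'/rW].
rewrite bigcup_mkcond; apply: countable_bigcupT_measurable => // q.
by case: ifP => // _; apply: measurableX; exact: measurable_itv.
Qed.

Section IndependentSamples.
Context d (T : measurableType d) (R : realType).

Definition tuple_cons n (p : T * n.-tuple T) : n.+1.-tuple T :=
  [tuple of p.1 :: p.2].

Lemma measurable_tuple_cons n : measurable_fun setT (@tuple_cons n).
Proof. exact: measurable_cons. Qed.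

HB.instance Definition _ n :=
  isMeasurableFun.Build _ _ _ _ (@tuple_cons n) (@measurable_tuple_cons n).

(* The product measure mu^n, i.e. the law of n independent points sampled
   from mu. *)
Fixpoint iid (mu : probability T R) n : probability (n.-tuple T) R :=
  if n is n'.+1 then distribution (mu \x iid mu n')%E (@tuple_cons n')
  else \d_ [tuple].

End IndependentSamples.

Section PlaneOrderTypes.
Variable R : realType.
Implicit Types p q r : (R * R)%type.

Definition is_line (L : set (R * R)) :=
  exists a b c : R,
    (a, b) != (0, 0) /\ L = [set p | a * p.1 + b * p.2 = c].

Definition collinear p q r := exists L, is_line L /\ [/\ L p, L q & L r].

(* 1, -1 or 0 according to whether the triangle pqr is counter-clockwise,
   clockwise or degenerate. *)
Definition orientation p q r : R :=
  Num.sg ((q.1 - p.1) * (r.2 - p.2) - (q.2 - p.2) * (r.1 - p.1)).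

Definition general_position (P : {fset R * R}) := forall p q r,
  p \in P -> q \in P -> r \in P -> p != q -> q != r -> p != r ->
  ~ collinear p q r.

Record point_set := PointSet {
  points :> {fset R * R};
  _ : `[< general_position points >] }.

HB.instance Definition _ := [isSub for points].
HB.instance Definition _ := [Choice of point_set by <:].

Definition same_order_type (P Q : point_set) :=
  exists f : points P -> points Q, bijective f /\
    forall p q r : points P, p != q -> q != r -> p != r ->
      orientation (val (f p)) (val (f q)) (val (f r)) =
      orientation (val p) (val q) (val r).

Definition same_order_typeb (P Q : point_set) := `[< same_order_type P Q >].

Lemma same_order_type_refl : reflexive same_order_typeb.
Proof. by move=> P; apply/asboolP; exists id; split=> //; exists id. Qed.

Lemma same_order_type_imp P Q : same_order_typeb P Q -> same_order_typeb Q P.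
Proof.
move=> /asboolP[f [[g fK gK] fE]]; apply/asboolP; exists g; split.
  by exists f.
move=> p q r pq qr pr.
by rewrite -fE ?gK// (can_eq gK).
Qed.

Lemma same_order_type_sym : symmetric same_order_typeb.
Proof. by move=> P Q; apply/idP/idP; exact: same_order_type_imp. Qed.

Lemma same_order_type_trans : transitive same_order_typeb.
Proof.
move=> Q P S /asboolP[f [bf fE]] /asboolP[g [bg gE]]; apply/asboolP.
exists (g \o f); split=> [|p q r pq qr pr]; first exact: bij_comp.
by rewrite /= gE ?fE// (bij_eq bf).
Qed.

Canonical same_order_type_equiv := EquivRel same_order_typeb
  same_order_type_refl same_order_type_sym same_order_type_trans.

Definition order_type := {eq_quot same_order_type_equiv}.

Definition order_type_size (w : order_type) : nat := #|` points (repr w)|.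

Definition has_order_type (w : order_type) n (x : n.-tuple (R * R)%type) :=
  exists P : point_set,
    points P = [fset p in (x : seq (R * R))]%fset /\ \pi_order_type P = w.

(* When n is the size of w, the points of a sample that has_order_type w are
   pairwise distinct. *)
Definition ell (mu : probability (R * R)%type R) (w : order_type) : \bar R :=
  iid mu (order_type_size w) [set x | has_order_type w x].

Definition msupport (mu : probability (R * R)%type R) : set (R * R) :=
  [set p | forall U : set (R * R), open U -> U p -> (0 < mu U)%E].

Definition homogeneous p : 'cV[R]_3 :=
  \col_(i < 3) (if i == 0 then p.1 else if i == 1 then p.2 else 1).

(* The points of R^2 that lie in the image of A under the projective
   transformation of P^2(R) defined by an invertible matrix M, where (x, y) in
   R^2 is identified with [x : y : 1]; points of A mapped to the line at
   infinity do not contribute. *)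
Definition projective_image (M : 'M[R]_3) (A : set (R * R)) : set (R * R) :=
  [set q | exists2 p, A p &
     exists2 c : R, c != 0 & M *m homogeneous p = c *: homogeneous q].

End PlaneOrderTypes.

(* Main.v *)
Require Import Defs.
From mathcomp Require Import all_boot all_order all_algebra.
From mathcomp Require Import all_classical all_reals all_analysis.
From mathcomp Require Import generic_quotient finmap measurable_realfun ring lra.

(* Large independent samples from the two measures that have the same order type
   can be matched so as to preserve all orientations while their empirical
   measures approximate [mu1] and [mu2].  An ultralimit of the matchings is a
   finitely additive coupling of [mu1] and [mu2] whose support [K] weakly
   preserves orientations.  Since lines are null, [K] is the graph of an
   injection; on an open set it is continuous, hence preserves collinearity, so
   it is projective there by a local form of the fundamental theorem of
   projective geometry.  The position of any point is determined by its
   orientations with respect to pairs of points of an open set, so all of [K]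
   lies on the graph of one projective map, which therefore transports [mu1] to
   [mu2]. *)

Set Implicit Arguments.
Unset Strict Implicit.
Unset Printing Implicit Defensive.
Import Order.TTheory GRing.Theory Num.Theory.
Import numFieldNormedType.Exports.
Local Open Scope classical_set_scope.
Local Open Scope ring_scope.

(** * Determinants and orientations *)

(** An order type forgets labels, and the bijection realising an equality of order types changes
    with the sample, so no map between the planes is given at the start. What survives a limit is
    the frequency with which matched pairs fall in a subset of the product. Taking the limit along
    an ultrafilter defines it on all subsets but loses countable additivity; information is
    therefore extracted only through open sets, compact sets and finite unions of rational boxes.
    Equality of [ell] enters through one counting fact: two sample events whose probabilities add up
    to more than 1 share an order type. Triangles may degenerate in the limit, so signs pass to [K]
    only as [0 <= _ * _]; strictness is recovered by choosing auxiliary points of [K] off null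
    lines. *)

Section Determinants.
Variable R : realType.
Implicit Types (p q r : (R * R)%type) (u v w : 'cV[R]_3).

Definition area p q r : R :=
  (q.1 - p.1) * (r.2 - p.2) - (q.2 - p.2) * (r.1 - p.1).

Lemma orientationE p q r : orientation p q r = Num.sg (area p q r).
Proof. by []. Qed.

(** The determinant of [homogeneous p], [homogeneous q] and [u]: the linear extension of [area p q]
    to vectors that may represent points at infinity. *)
Definition area_vec p q (u : 'cV[R]_3) : R :=
  (p.2 - q.2) * u 0 0 + (q.1 - p.1) * u 1 0 + (p.1 * q.2 - p.2 * q.1) * u 2%:R 0.

Lemma homogeneousE p :
  (homogeneous p 0 0 = p.1) * (homogeneous p 1 0 = p.2) *
  (homogeneous p 2%:R 0 = 1).
Proof. by rewrite /homogeneous !mxE. Qed.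

Lemma ord3P (i : 'I_3) : [\/ i = 0, i = 1 | i = 2%:R].
Proof.
case: i => -[|[|[|//]]] hi; [apply: Or31|apply: Or32|apply: Or33]; exact: val_inj.
Qed.

Lemma col3P u v : u 0 0 = v 0 0 -> u 1 0 = v 1 0 -> u 2%:R 0 = v 2%:R 0 -> u = v.
Proof.
move=> h0 h1 h2; apply/matrixP => i j; rewrite (ord1 j).
by case: (ord3P i) => ->.
Qed.

Lemma area_vec_homogeneous p q r : area_vec p q (homogeneous r) = area p q r.
Proof. by rewrite /area_vec !homogeneousE /area; ring. Qed.

(* With [b := a + t (x + y)], where [x] and [y] are the directions from [a] to
   the projective points [u] and [v], the product of the two determinants is
   [- t ^+ 2 * det (x, y) ^+ 2]. *)
Lemma area_vec_separation (U : set (R * R)) u v :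
  open U -> U !=set0 ->
  (forall a b, U a -> U b -> 0 <= area_vec a b u * area_vec a b v) ->
  forall i j, u i 0 * v j 0 = u j 0 * v i 0.
Proof.
move=> oU [c Uc] H.
have near_dir a (x y : R) : U a ->
    exists2 t : R, 0 < t & U (a.1 + t * x, a.2 + t * y).
  move=> Ua.
  have cf : (fun t : R => (a.1 + t * x, a.2 + t * y)) @ 0 --> a.
    rewrite [X in _ --> X](_ : a = (a.1 + 0 * x, a.2 + 0 * y)); last first.
      by rewrite !mul0r !addr0; case: (a).
    apply: (@cvg_pair _ _ _ _ (nbhs (a.1 + 0 * x)) (nbhs (a.2 + 0 * y)));
      by apply: cvgD; [exact: cvg_cst|apply: cvgM; [exact: cvg_id|exact: cvg_cst]].
  have /cf /nbhs_ballP[e /= e0 He] : nbhs a U by exact: open_nbhs_nbhs.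
  exists (e / 2); first by rewrite divr_gt0.
  apply: He; rewrite /ball /= sub0r normrN gtr0_norm ?divr_gt0//.
  by rewrite ltr_pdivrMr// ltr_pMr// ltr1n.
pose D (a : R * R) := (u 0 0 - u 2%:R 0 * a.1) * (v 1 0 - v 2%:R 0 * a.2)
  - (u 1 0 - u 2%:R 0 * a.2) * (v 0 0 - v 2%:R 0 * a.1).
have D0 a : U a -> D a = 0.
  move=> Ua; apply/eqP/negPn/negP => Dneq0.
  pose x := (u 0 0 - u 2%:R 0 * a.1) + (v 0 0 - v 2%:R 0 * a.1).
  pose y := (u 1 0 - u 2%:R 0 * a.2) + (v 1 0 - v 2%:R 0 * a.2).
  have [t t0 Ub] := near_dir a x y Ua.
  have := H _ _ Ua Ub.
  rewrite (_ : _ * _ = - (t * D a) ^+ 2); last first.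
    by rewrite /area_vec /D /x /y /=; ring.
  by rewrite oppr_ge0 leNgt exprn_even_gt0//= mulf_neq0// gt_eqF.
(* The quadratic terms of [D] cancel, and its affine coefficients are the coordinates of the cross
   product of [u] and [v]; they vanish because [D] vanishes on an open set. *)
pose A := u 1 0 * v 2%:R 0 - u 2%:R 0 * v 1 0.
pose B := u 2%:R 0 * v 0 0 - u 0 0 * v 2%:R 0.
pose C := u 0 0 * v 1 0 - u 1 0 * v 0 0.
have DE a : D a = A * a.1 + B * a.2 + C by rewrite /D /A /B /C; ring.
have A0 : A = 0.
  have [t t0 Ub] := near_dir c 1 0 Uc.
  have := D0 _ Ub; have := D0 _ Uc; rewrite !DE /= => e1 e2.
  have : A * t = 0 by lra.
  by move/eqP; rewrite mulf_eq0 (gt_eqF t0) orbF => /eqP.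
have B0 : B = 0.
  have [t t0 Ub] := near_dir c 0 1 Uc.
  have := D0 _ Ub; have := D0 _ Uc; rewrite !DE /= => e1 e2.
  have : B * t = 0 by lra.
  by move/eqP; rewrite mulf_eq0 (gt_eqF t0) orbF => /eqP.
have C0 : C = 0 by have := D0 _ Uc; rewrite DE A0 B0 !mul0r !add0r.
move: A0 B0 C0; rewrite /A /B /C => A0 B0 C0 i j.
by case: (ord3P i) => ->; case: (ord3P j) => -> //; lra.
Qed.

Lemma area_separation (U : set (R * R)) p q :
  open U -> U !=set0 ->
  (forall a b, U a -> U b -> 0 <= area a b p * area a b q) -> p = q.
Proof.
move=> oU U0 H.
have E := @area_vec_separation U (homogeneous p) (homogeneous q) oU U0.
have {E}E : forall i j, homogeneous p i 0 * homogeneous q j 0 =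
    homogeneous p j 0 * homogeneous q i 0.
  by apply: E => a b Ua Ub; rewrite !area_vec_homogeneous; exact: H.
have := E 0 2%:R; have := E 1 2%:R; rewrite !homogeneousE !mulr1 !mul1r.
by move=> e2 e1; rewrite [p]surjective_pairing [q]surjective_pairing e1 e2.
Qed.

(* In coordinates where [a] and [b] are points at infinity and [d] is the
   origin, the coordinate of [p] transversal to the pencil of lines through the
   point [z] of the line [ab]. *)
Definition pencil_coord a b d z p : R := area p z d / area a b p.

Lemma collinear_combination a b z : area a b z = 0 -> a != b ->
  exists l, z.1 = l * a.1 + (1 - l) * b.1 /\ z.2 = l * a.2 + (1 - l) * b.2.
Proof.
move=> abz neq; have : (b.1 != a.1) || (b.2 != a.2).
  rewrite -negb_and; apply: contra neq => /andP[/eqP h1 /eqP h2].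
  by rewrite [a]surjective_pairing [b]surjective_pairing h1 h2.
move=> /orP[] n; [exists ((b.1 - z.1) / (b.1 - a.1))
                 |exists ((b.2 - z.2) / (b.2 - a.2))].
- have n' : b.1 - a.1 != 0 by rewrite subr_eq0.
  split; first by field.
  apply: (mulfI n'); move: abz; rewrite /area => abz.
  transitivity ((b.2 - a.2) * (z.1 - a.1) + (b.1 - a.1) * a.2); first lra.
  by field.
- have n' : b.2 - a.2 != 0 by rewrite subr_eq0.
  split; last by field.
  apply: (mulfI n'); move: abz; rewrite /area => abz.
  transitivity ((b.1 - a.1) * (z.2 - a.2) + (b.2 - a.2) * a.1); first lra.
  by field.
Qed.

(** For [z] on the line [ab], cross-multiplying the two coordinates leaves a difference of exactly
    [area a b d * area p z q], so the coordinate labels the lines of the pencil through [z]. *)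
Lemma pencil_coord_collinear a b d z p q : area a b z = 0 -> a != b ->
  area a b d != 0 -> area a b p != 0 -> area a b q != 0 ->
  pencil_coord a b d z p = pencil_coord a b d z q <-> area p z q = 0.
Proof.
move=> abz neq d0 p0 q0.
have [l [e1 e2]] := collinear_combination abz neq.
have e : area p z d * area a b q - area q z d * area a b p =
   area a b d * area p z q by rewrite /area e1 e2; ring.
rewrite /pencil_coord; split=> [/eqP|pzq].
  rewrite eqr_div// => /eqP h; move/eqP: e; rewrite h subrr eq_sym mulf_eq0.
  by rewrite (negbTE d0) => /eqP.
by apply/eqP; rewrite eqr_div//; move/eqP: e; rewrite pzq mulr0 subr_eq0.
Qed.

Definition col3_mx u v w : 'M[R]_3 :=
  \matrix_(i, j) (if j == 0 then u i 0 else if j == 1 then v i 0 else w i 0).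

Lemma mulmx_col3 (N : 'M[R]_3) u v w :
  N *m col3_mx u v w = col3_mx (N *m u) (N *m v) (N *m w).
Proof.
apply/matrixP => i j; rewrite !mxE; under eq_bigr do rewrite mxE.
by case: (j == 0); [|case: (j == 1)].
Qed.

Lemma det_col3 u v w : \det (col3_mx u v w) =
  u 0 0 * (v 1 0 * w 2%:R 0 - v 2%:R 0 * w 1 0) -
  v 0 0 * (u 1 0 * w 2%:R 0 - u 2%:R 0 * w 1 0) +
  w 0 0 * (u 1 0 * v 2%:R 0 - u 2%:R 0 * v 1 0).
Proof.
rewrite (expand_det_row _ ord0) !big_ord_recl big_ord0 /cofactor.
rewrite !(expand_det_row _ ord0) !big_ord_recl !big_ord0 /cofactor !det_mx11 !mxE /=.
have -> : lift ord0 (ord0 : 'I_2) = 1 :> 'I_3 by exact: val_inj.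
have -> : lift ord0 (lift ord0 (ord0 : 'I_1)) = 2%:R :> 'I_3 by exact: val_inj.
rewrite /bump /=; ring.
Qed.

Lemma det_col3_homogeneous p q u :
  \det (col3_mx (homogeneous p) (homogeneous q) u) = area_vec p q u.
Proof. by rewrite det_col3 !homogeneousE /area_vec; ring. Qed.

End Determinants.

(** * The law of large numbers *)

Section LawOfLargeNumbers.
Local Open Scope ereal_scope.
Context d (T : measurableType d) (R : realType).
Variable mu : probability T R.

Definition hits (B : set T) (s : seq T) : nat := count (fun x => `[< B x >]) s.

Lemma hits_cons B x s : hits B (x :: s) = (`[< B x >] + hits B s)%N.
Proof. by []. Qed.

Lemma ge0_integral_iidS n (F : n.+1.-tuple T -> \bar R) :
  measurable_fun [set: n.+1.-tuple T] F -> (forall t, 0 <= F t) ->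
  \int[iid mu n.+1]_t F t = \int[iid mu n]_t \int[mu]_x F (tuple_cons (x, t)).
Proof.
move=> mF F0 /=; rewrite (ge0_integral_distribution _ mF)//.
rewrite (fubini_tonelli2 (F \o @tuple_cons _ T n))//; last first.
  by move=> x; exact: F0.
by apply: (measurableT_comp mF); exact: measurable_tuple_cons.
Qed.

Lemma measurable_hits n (B : set T) : measurable B ->
  measurable_fun [set: n.-tuple T] (fun t : n.-tuple T => (hits B t)%:R : R).
Proof.
move=> mB.
rewrite (_ : (fun _ => _) = fun t => \sum_(i < n) \1_B (tnth t i) : R)%R.
  apply: measurable_sum => i.
  have mI : measurable_fun [set: T] (\1_B : T -> R) by exact: measurable_indic.
  exact: (measurableT_comp mI (measurable_tnth i)).
apply/funext => t; rewrite /hits -sum1_count natr_sum big_mkcond/= big_tuple.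
apply: eq_bigr => i _; rewrite indicE; case: asboolP => Bi.
  by rewrite mem_set.
by rewrite memNset.
Qed.

Lemma integral_two_values (B : set T) (u v : R) : measurable B ->
  (0 <= u)%R -> (0 <= v)%R ->
  \int[mu]_x (if `[< B x >] then u else v)%:E =
  (u * fine (mu B) + v * (1 - fine (mu B)))%:E.
Proof.
move=> mB u0 v0.
have -> : (fun x => (if `[< B x >] then u else v)%:E) =
    fun x => (u * \1_B x)%:E + (v * \1_(~` B) x)%:E.
  apply/funext => x; rewrite !indicE in_setC; case: asboolP => Bx.
    by rewrite mem_set//= mulr1 mulr0 adde0.
  by rewrite memNset//= mulr1 mulr0 add0e.
rewrite ge0_integralD//=; last 4 first.
- by move=> x _; rewrite lee_fin mulr_ge0.
- by apply/measurable_EFinP; apply: measurable_funM => //; exact: measurable_indic.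
- by move=> x _; rewrite lee_fin mulr_ge0.
- apply/measurable_EFinP; apply: measurable_funM => //; apply: measurable_indic.
  exact: measurableC.
have I (w : R) A : measurable A -> (0 <= w)%R ->
    \int[mu]_x (w * \1_A x)%:E = w%:E * mu A.
  move=> mA w0; under eq_integral do rewrite EFinM.
  rewrite ge0_integralZl//; first by rewrite integral_indic// setIT.
  by apply/measurable_EFinP; exact: measurable_indic.
rewrite !I//; last exact: measurableC.
rewrite probability_setC// -[in LHS](@fineK _ (mu B)) ?fin_num_measure//.
Qed.

(** The binomial variance, by induction: one more sample point shifts the deviation [w] by [1 - p]
    with probability [p] and by [- p] otherwise; the term linear in [w] averages to zero and
    [p * (1 - p)] is added. *)
Lemma integral_hits_variance n (B : set T) : measurable B ->
  \int[iid mu n]_t (((hits B t)%:R - n%:R * fine (mu B)) ^+ 2)%:E =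
  (n%:R * (fine (mu B) * (1 - fine (mu B))))%:E.
Proof.
move=> mB; set p := fine (mu B).
have mD m : measurable_fun [set: m.-tuple T]
    (fun t : m.-tuple T => (((hits B t)%:R - m%:R * p) ^+ 2)%:E : \bar R).
  apply/measurable_EFinP; apply: measurable_funX; apply: measurable_funB => //.
  exact: measurable_hits.
have p01 : (0 <= p * (1 - p))%R.
  by rewrite mulr_ge0 ?fine_ge0// subr_ge0 -lee_fin fineK ?fin_num_measure// probability_le1.
elim: n => [|n IHn].
  rewrite (_ : (fun _ => _) = cst 0) ?integral0 ?mulr0n ?mul0r//.
  by apply/funext => t; rewrite (tuple0 t)/= subr0 expr0n.
rewrite ge0_integral_iidS//; last by move=> t; rewrite lee_fin sqr_ge0.
transitivity (\int[iid mu n]_t ((((hits B t)%:R - n%:R * p) ^+ 2)%:E + (p * (1 - p))%:E)).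
  apply: eq_integral => t _.
  pose w : R := ((hits B t)%:R - n%:R * p)%R.
  transitivity (\int[mu]_x (if `[< B x >] then (w + (1 - p)) ^+ 2 else (w - p) ^+ 2)%:E).
    apply: eq_integral => x _; congr EFin; rewrite hits_cons -/p /w.
    by case: (`[< B x >]) => /=; rewrite ?add1n ?add0n -?natr1; ring.
  rewrite integral_two_values ?sqr_ge0// -EFinD; congr EFin; rewrite -/p -/w; ring.
rewrite ge0_integralD//; last 2 first.
- by move=> t _; rewrite lee_fin sqr_ge0.
- exact: mD.
rewrite IHn integral_cst//= probability_setT mule1 -EFinD -natr1; congr EFin; ring.
Qed.

Lemma hits_chebyshev n (B : set T) (e : R) : measurable B -> (0 < e)%R ->
  (0 < n)%N ->
  iid mu n [set t : n.-tuple T | (e * n%:R <= `|(hits B t)%:R - n%:R * fine (mu B)|)%R] <=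
  (e ^- 2 / n%:R)%:E.
Proof.
move=> mB e0 n0; set p := fine (mu B).
have n0' : (0 < n%:R :> R)%R by rewrite ltr0n.
have en0 : (0 < (e * n%:R) ^+ 2)%R by rewrite exprn_gt0// mulr_gt0.
set E := [set t : n.-tuple T | _].
have mE : measurable E.
  rewrite -[E]setTI /E.
  apply: (@measurable_fun_le _ _ _ _ (cst (e * n%:R)%R)) => //=.
  apply: (measurableT_comp (@normr_measurable R setT)).
  by apply: measurable_funB => //; exact: measurable_hits.
have mI : measurable_fun [set: n.-tuple T] (\1_E : n.-tuple T -> R).
  exact: measurable_indic.
have : ((e * n%:R) ^+ 2)%:E * iid mu n E <= (n%:R * (p * (1 - p)))%:E.
  rewrite -(integral_hits_variance n mB) -/p -[E in X in X <= _]setIT -integral_indic//.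
  rewrite -ge0_integralZl//; last 2 first.
    by apply/measurable_EFinP.
    by rewrite lee_fin ltW.
  apply: ge0_le_integral => //.
  - by move=> t _; rewrite -EFinM lee_fin mulr_ge0// ltW.
  - by apply/measurable_EFinP; apply: measurable_funM.
  - apply/measurable_EFinP; apply: measurable_funX; apply: measurable_funB => //.
    exact: measurable_hits.
  - move=> t _; rewrite -EFinM lee_fin indicE.
    have [Et|nEt] := pselect (E t); last by rewrite memNset//= mulr0 sqr_ge0.
    rewrite mem_set//= mulr1; have h : (_ <= _)%R := Et.
    by rewrite -[leRHS]real_normK ?num_real// lerXn2r// nnegrE// ltW// mulr_gt0.
have fE : iid mu n E \is a fin_num by rewrite fin_num_measure.
rewrite -(fineK fE) -EFinM !lee_fin mulrC => h.
have p1 : (p * (1 - p) <= 1)%R.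
  by nra.
rewrite -ler_pdivlMr in h => //; apply: (le_trans h).
rewrite ler_pdivrMr//.
rewrite [leRHS](_ : _ = n%:R)%R; last by field; rewrite !gt_eqF.
by rewrite ler_piMr// ltW.
Qed.

End LawOfLargeNumbers.

(** * General position *)

Section GeneralPosition.
Variable R : realType.
Notation T := (R * R)%type.
Implicit Types (p q r : T) (s : seq T).

Lemma area_rot p q r : area p q r = area q r p.
Proof. by rewrite /area; ring. Qed.

Lemma area_swap p q r : area p q r = - area q p r.
Proof. by rewrite /area; ring. Qed.

Lemma area_diagl p q : area p p q = 0.
Proof. by rewrite /area; ring. Qed.

Lemma area_diagr p q : area p q q = 0.
Proof. by rewrite /area; ring. Qed.

Lemma area_diag p q : area p q p = 0.
Proof. by rewrite /area; ring. Qed.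

Lemma is_line_area p q : p != q -> is_line [set x | area x p q = 0].
Proof.
move=> pq; exists (p.2 - q.2), (q.1 - p.1), (p.2 * q.1 - p.1 * q.2); split.
  apply: contra pq => /eqP[/eqP h2 /eqP h1]; move: h1 h2; rewrite !subr_eq0.
  move=> /eqP h1 /eqP h2; apply/eqP.
  by rewrite [p]surjective_pairing [q]surjective_pairing h1 h2.
by apply/seteqP; split=> x /=; rewrite /area => h; lra.
Qed.

Lemma collinearP p q r : collinear p q r <-> area p q r = 0.
Proof.
split=> [[L [[a [b [c [ab ->]]]]]] [/= hp hq hr]|].
  have e1 : a * area p q r = 0.
    have -> : a * area p q r = (a * q.1 - a * p.1) * (r.2 - p.2)
      - (q.2 - p.2) * (a * r.1 - a * p.1) by rewrite /area; ring.
    have -> : a * p.1 = c - b * p.2 by lra.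
    have -> : a * q.1 = c - b * q.2 by lra.
    have -> : a * r.1 = c - b * r.2 by lra.
    by ring.
  have e2 : b * area p q r = 0.
    have -> : b * area p q r = (q.1 - p.1) * (b * r.2 - b * p.2)
      - (b * q.2 - b * p.2) * (r.1 - p.1) by rewrite /area; ring.
    have -> : b * p.2 = c - a * p.1 by lra.
    have -> : b * q.2 = c - a * q.1 by lra.
    have -> : b * r.2 = c - a * r.1 by lra.
    by ring.
  apply: contrapT => /eqP n; move: ab.
  move/eqP: e1; rewrite mulf_eq0 (negbTE n) orbF => /eqP ->.
  by move/eqP: e2; rewrite mulf_eq0 (negbTE n) orbF => /eqP ->; rewrite eqxx.
move=> h; have [->|qr] := eqVneq q r; last first.
  exists [set x | area x q r = 0]; split; first exact: is_line_area.
  by split => //=; rewrite ?area_diagl ?area_diag.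
have [->|pr] := eqVneq p r; last first.
  exists [set x | area x p r = 0]; split; first exact: is_line_area.
  by split => //=; rewrite ?area_diagl ?area_diag.
exists [set x | x.1 = r.1]; split => //; exists 1, 0, r.1; split.
  by apply/eqP => -[/eqP]; rewrite oner_eq0.
by apply/seteqP; split=> x /= e; lra.
Qed.

Definition generic s := uniq s /\ forall p q r, p \in s -> q \in s -> r \in s ->
  p != q -> q != r -> p != r -> area p q r != 0.

Lemma generic_general_position s : uniq s ->
  generic s <-> general_position [fset p in s]%fset.
Proof.
move=> us; split=> [[_ g] p q r|g].
  by rewrite !inE => ps qs rs pq qr pr /collinearP; apply/eqP; exact: g.
split=> // p q r ps qs rs pq qr pr; apply/eqP => /collinearP.
by apply: g; rewrite ?inE.
Qed.

Lemma generic_cons x s : generic s ->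
  (forall p q, p \in s -> q \in s -> p != q -> area x p q != 0) ->
  x \notin s -> generic (x :: s).
Proof.
move=> [us gs] H xs; split; first by rewrite /= xs us.
move=> p q r; rewrite !in_cons => /predU1P[->|ps] /predU1P[->|qs] /predU1P[->|rs];
  rewrite ?eqxx// => pq qr pr.
- exact: H.
- by rewrite area_rot; apply: H => //; rewrite eq_sym.
- by rewrite -area_rot; apply: H.
- exact: gs.
Qed.

Section Measurability.
Variable n : nat.

Lemma measurable_forall (I : finType) (P : I -> n.-tuple T -> Prop) :
  (forall i, measurable [set t | P i t]) ->
  measurable [set t | forall i, P i t].
Proof.
move=> mP; rewrite (_ : [set t | _] = \bigcap_(i in [set: I]) [set t | P i t]).
  by apply: fin_bigcap_measurable => // i _; exact: mP.
by apply/seteqP; split=> t /= h i; [move=> _|]; apply: h.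
Qed.

Lemma measurable_area (i j k : 'I_n) : measurable_fun [set: n.-tuple T]
  (fun t => area (tnth t i) (tnth t j) (tnth t k)).
Proof.
have m1 l : measurable_fun [set: n.-tuple T] (fun t => (tnth t l).1).
  exact: (measurableT_comp measurable_fst (measurable_tnth l)).
have m2 l : measurable_fun [set: n.-tuple T] (fun t => (tnth t l).2).
  exact: (measurableT_comp measurable_snd (measurable_tnth l)).
by apply: measurable_funB; apply: measurable_funM; exact: measurable_funB.
Qed.

Lemma measurable_area_gt0 (i j k : 'I_n) (b : bool) : measurable
  [set t : n.-tuple T | (0 < area (tnth t i) (tnth t j) (tnth t k)) = b].
Proof.
have m0 : measurable_fun [set: n.-tuple T] (cst (0 : R)) by exact: measurable_cst.
have := measurable_fun_ltr m0 (measurable_area i j k).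
by move=> /(_ measurableT [set b]); rewrite setTI; apply.
Qed.

Lemma measurable_area_eq0 (i j k : 'I_n) : measurable
  [set t : n.-tuple T | area (tnth t i) (tnth t j) (tnth t k) = 0].
Proof.
have := measurable_area i j k measurableT (measurable_set1 0).
by rewrite setTI.
Qed.

Lemma measurable_tnth_eq (i j : 'I_n) :
  measurable [set t : n.-tuple T | tnth t i = tnth t j].
Proof.
have m1 l : measurable_fun [set: n.-tuple T] (fun t => (tnth t l).1).
  exact: (measurableT_comp measurable_fst (measurable_tnth l)).
have m2 l : measurable_fun [set: n.-tuple T] (fun t => (tnth t l).2).
  exact: (measurableT_comp measurable_snd (measurable_tnth l)).
have k1 := measurable_funB (m1 i) (m1 j) measurableT (measurable_set1 0).
have k2 := measurable_funB (m2 i) (m2 j) measurableT (measurable_set1 0).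
have := measurableI _ _ k1 k2; rewrite !setTI; congr measurable.
apply/seteqP; split=> t /=; last by move=> ->; rewrite !subrr.
move=> [/eqP + /eqP]; rewrite !subr_eq0 => /eqP e1 /eqP e2.
by rewrite [LHS]surjective_pairing e1 e2 -surjective_pairing.
Qed.

Lemma generic_tnthP (t : n.-tuple T) : generic t <->
  (forall ij : 'I_n * 'I_n, ij.1 != ij.2 -> tnth t ij.1 <> tnth t ij.2) /\
  (forall u : 'I_n * 'I_n * 'I_n, u.1.1 != u.1.2 -> u.1.2 != u.2 -> u.1.1 != u.2 ->
    area (tnth t u.1.1) (tnth t u.1.2) (tnth t u.2) <> 0).
Proof.
split=> [[ut g]|[ht g]].
  have inj i j : i != j -> tnth t i != tnth t j.
    by move=> ij; apply: contra ij => /eqP /(tuple_uniqP _ ut) ->.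
  split=> [[i j]/= ij|[[i j] k] /= ij jk ik]; first exact/eqP/inj.
  by apply/eqP/g; rewrite ?mem_tnth ?inj.
split.
  apply/tuple_uniqP => i j tij; apply/eqP; apply: contraT => ij.
  by have := ht (i, j) ij.
move=> p q r /tnthP[i ->] /tnthP[j ->] /tnthP[k ->] pq qr pr.
apply/eqP/(g (i, j, k)) => /=.
- by apply: contra pq => /eqP ->.
- by apply: contra qr => /eqP ->.
- by apply: contra pr => /eqP ->.
Qed.

Lemma measurable_generic : measurable [set t : n.-tuple T | generic t].
Proof.
rewrite (_ : [set t | _] = [set t | forall ij : 'I_n * 'I_n,
    ij.1 != ij.2 -> tnth t ij.1 <> tnth t ij.2] `&`
  [set t | forall u : 'I_n * 'I_n * 'I_n, u.1.1 != u.1.2 -> u.1.2 != u.2 ->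
    u.1.1 != u.2 -> area (tnth t u.1.1) (tnth t u.1.2) (tnth t u.2) <> 0]); last first.
  by apply/seteqP; split=> t /= /generic_tnthP.
have mimp (b : bool) (P : n.-tuple T -> Prop) :
    measurable [set t | P t] -> measurable [set t | b -> P t].
  case: b => mP.
    by rewrite (_ : [set t | _] = [set t | P t])//; apply/seteqP; split=> t /=; auto.
  by rewrite (_ : [set t | _] = setT)//; apply/seteqP; split=> t.
apply: measurableI; apply: measurable_forall => u.
  apply: (mimp _ (fun t => tnth t u.1 <> tnth t u.2)).
  exact: (measurableC (measurable_tnth_eq u.1 u.2)).
apply: (mimp _ (fun t => _ -> _ -> _)).
apply: (mimp _ (fun t => _ -> _)).
apply: (mimp _ (fun t => area (tnth t u.1.1) (tnth t u.1.2) (tnth t u.2) <> 0)).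
exact: (measurableC (measurable_area_eq0 u.1.1 u.1.2 u.2)).
Qed.

(** For a generic tuple these bits determine all orientations, and only finitely many patterns
    exist. Events about order types thus become finite unions of measurable sets. *)
Definition chirotope (t : n.-tuple T) : {ffun 'I_n * 'I_n * 'I_n -> bool} :=
  [ffun u => 0 < area (tnth t u.1.1) (tnth t u.1.2) (tnth t u.2)].

Lemma measurable_chirotope c : measurable [set t : n.-tuple T | chirotope t = c].
Proof.
rewrite (_ : [set t | _] = [set t | forall u : 'I_n * 'I_n * 'I_n,
    (0 < area (tnth t u.1.1) (tnth t u.1.2) (tnth t u.2)) = c u]); last first.
  apply/seteqP; split=> t /=; first by move=> <- u; rewrite ffunE.
  by move=> h; apply/ffunP => u; rewrite ffunE h.
by apply: measurable_forall => u; exact: measurable_area_gt0.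
Qed.

End Measurability.

Section Null.
Variable mu : probability (R * R)%type R.
Hypothesis line_mu : forall L : set (R * R), is_line L -> mu L = 0%E.

Lemma measurable_line (L : set (R * R)) : is_line L -> measurable L.
Proof.
move=> [a [b [c [_ ->]]]].
have mf : measurable_fun [set: T] (fun p : T => a * p.1 + b * p.2).
  by apply: measurable_funD; apply: measurable_funM.
by have := mf measurableT _ (measurable_set1 c); rewrite setTI.
Qed.

Lemma negligible_seq (I : eqType) (s : seq I) (F : I -> set T) :
  (forall i, i \in s -> mu.-negligible (F i)) ->
  mu.-negligible [set x | exists2 i, i \in s & F i x].
Proof.
elim: s => [|i s IH] H.
  by apply: negligibleS (@negligible_set0 _ _ _ mu) => x [].
apply: negligibleS (negligibleU (H i (mem_head _ _)) (IH _)).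
  by move=> x [j]; rewrite in_cons => /predU1P[->|js Fj]; [left|right; exists j].
by move=> j js; apply: H; rewrite in_cons js orbT.
Qed.

Lemma negligible_line (L : set (R * R)) : is_line L -> mu.-negligible L.
Proof.
by move=> lL; apply/negligibleP; [exact: measurable_line|exact: line_mu].
Qed.

Lemma negligible_not_generic_cons s : generic s ->
  mu.-negligible [set x | ~ generic (x :: s)].
Proof.
move=> gs.
(* A bad position lies on a line through two points of [s] or is itself a point of [s]; the latter
   are covered by vertical lines, which are null. *)
apply: negligibleS (negligibleU
  (@negligible_seq _ s (fun p => [set x : T | x.1 = p.1]) _)
  (@negligible_seq _ [seq (p, q) | p <- s, q <- s]
     (fun pq => [set x | pq.1 != pq.2 /\ area x pq.1 pq.2 = 0]) _)).
- move=> x /= H; apply: contrapT => /not_orP[n1 n2]; apply: H.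
  apply: generic_cons => // [p q ps qs pq|].
    apply/eqP => a0; apply: n2; exists (p, q) => //.
    exact: allpairs_f.
  by apply/negP => xs; apply: n1; exists x.
- move=> p ps; apply: negligible_line; exists 1, 0, p.1; split.
    by apply/eqP => -[/eqP]; rewrite oner_eq0.
  by apply/seteqP; split=> x /= e; lra.
move=> [p q] _ /=; have [->|pq] := eqVneq p q.
  by apply: negligibleS (@negligible_set0 _ _ _ mu) => x [].
apply: negligibleS (negligible_line (is_line_area pq)).
by move=> x [].
Qed.

(** By Tonelli and induction: over a generic tail the bad first points form a null set, and over the
    other tails, themselves null, the indicator is at most 1. *)
Lemma iid_generic n : iid mu n [set t : n.-tuple T | generic t] = 1%E.
Proof.
suff : iid mu n (~` [set t : n.-tuple T | generic t]) = 0%E.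
  have mg := @measurable_generic n; have fg := fin_num_measure (iid mu n) _ mg.
  rewrite probability_setC// -(fineK fg) -EFinB => /eqP.
  by rewrite eqe subr_eq0 => /eqP <-.
elim: n => [|n IHn].
  rewrite (_ : ~` _ = set0) ?measure0//; apply/seteqP; split=> // t /=.
  by rewrite (tuple0 t) => h; apply: h; split.
set A := ~` _.
have mA : measurable A by apply: measurableC; exact: measurable_generic.
have mI : measurable_fun [set: n.+1.-tuple T] (\1_A : n.+1.-tuple T -> R).
  exact: measurable_indic.
rewrite -[A]setIT -integral_indic// ge0_integral_iidS; last 2 first.
- exact/measurable_EFinP.
- by move=> t; rewrite lee_fin.
pose G t := (\int[mu]_x (\1_A (tuple_cons (x, t)))%:E)%E.
have mG : measurable_fun [set: n.-tuple T] G.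
  apply: (@measurable_fun_fubini_tonelli_G _ _ _ _ _ mu
    (fun z => (\1_A (tuple_cons z))%:E)) => /=; last by move=> x; rewrite lee_fin.
  apply/measurable_EFinP; apply: (measurableT_comp mI).
  exact: measurable_tuple_cons.
have mB : measurable (~` [set t : n.-tuple T | generic t]).
  by apply: measurableC; exact: measurable_generic.
apply/eqP; rewrite eq_le; apply/andP; split; last first.
  by apply: integral_ge0 => t _; apply: integral_ge0 => x _; rewrite lee_fin.
rewrite -[leRHS]IHn -[X in (_ <= iid mu n X)%E]setIT -integral_indic//.
apply: ge0_le_integral => //.
- by move=> t _; apply: integral_ge0 => x _; rewrite lee_fin.
- apply/measurable_EFinP; exact: measurable_indic.
move=> t _; have [gt|ngt] := pselect (generic t).
  have mC : measurable [set x | A (tuple_cons (x, t))].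
    have := @measurable_tuple_cons _ T n measurableT _ mA; rewrite setTI.
    move=> /(measurable_ysection t); congr measurable.
    by apply/seteqP; split=> x; rewrite /ysection/= ?in_setE.
  rewrite (_ : (fun x => _) = fun x => (\1_[set x | A (tuple_cons (x, t))] x)%:E).
    rewrite integral_indic// setIT measure_negligible// ?lee_fin//.
    exact: negligible_not_generic_cons.
  by apply/funext => x; rewrite !indicE; congr (_%:R%:E); apply/idP/idP;
    rewrite !in_setE.
rewrite indicE mem_set//=.
apply: (@le_trans _ _ (\int[mu]_x cst 1 x)%E); last first.
  by rewrite integral_cst//= probability_setT mule1.
apply: ge0_le_integral => //; [|move=> x _ /=; rewrite lee_fin indicE; by case: (_ \in _)].
apply/measurable_EFinP.
have mp : measurable_fun [set: T] (fun x : T => (x, t)).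
  exact: measurable_fun_pair.
exact: (measurableT_comp (measurableT_comp mI (@measurable_tuple_cons _ T n)) mp).
Qed.

End Null.
End GeneralPosition.

(** * Order types of samples *)

Section OrderTypes.
Variable R : realType.
Notation T := (R * R)%type.
Local Open Scope quotient_scope.

Lemma point_set_general_position (P : point_set R) : general_position (points P).
Proof. by case: P => A gA; exact/asboolP. Qed.

Lemma order_type_size_pi (P : point_set R) :
  order_type_size (\pi_(order_type R) P) = #|` points P|%fset.
Proof.
have /eqmodP/asboolP[f [bf _]] :
    (repr (\pi_(order_type R) P) = P %[mod order_type R])%qT by rewrite reprK.
by rewrite /order_type_size !cardfE; exact: bij_eq_card bf.
Qed.

(** [has_order_type] only sees the set of entries, so it is the cardinality of [w] that excludes
    repetitions. *)
Lemma has_order_type_generic n (w : order_type R) (x : n.-tuple T) :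
  order_type_size w = n -> has_order_type w x -> generic x.
Proof.
move=> sw [P [Px Pw]].
have ux : uniq x.
  have := order_type_size_pi P; rewrite Pw sw Px card_fseq => e.
  by rewrite -[uniq x]negbK -ltn_size_undup -e size_tuple ltnn.
by apply/(generic_general_position ux); rewrite -Px; exact: point_set_general_position.
Qed.

Lemma has_order_type_exists n (x : n.-tuple T) : generic x ->
  exists2 w, order_type_size w = n & has_order_type w x.
Proof.
move=> gx; have [ux _] := gx.
have /asboolP gP := (generic_general_position ux).1 gx.
exists (\pi_(order_type R) (PointSet gP)); last by exists (PointSet gP).
by rewrite order_type_size_pi/= card_fseq undup_id// size_tuple.
Qed.

Lemma has_order_type_inj n (w w' : order_type R) (x : n.-tuple T) :
  has_order_type w x -> has_order_type w' x -> w = w'.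
Proof.
move=> [P [Px <-]] [Q [Qx <-]]; congr (\pi_(order_type R) _).
by apply: val_inj; rewrite /= Px Qx.
Qed.

(** A false bit means [area <= 0]; genericity excludes zero for distinct indices, so one bit fixes
    the sign. *)
Lemma chirotope_area n (x y : n.-tuple T) (i j k : 'I_n) :
  generic x -> generic y -> chirotope x = chirotope y ->
  orientation (tnth x i) (tnth x j) (tnth x k) =
  orientation (tnth y i) (tnth y j) (tnth y k).
Proof.
move=> [ux gx] [uy gy] /ffunP cxy; rewrite !orientationE.
have [->|ij] := eqVneq i j; first by rewrite !area_diagl.
have [->|jk] := eqVneq j k; first by rewrite !area_diagr.
have [->|ik] := eqVneq i k; first by rewrite !area_diag.
have inj (z : n.-tuple T) (uz : uniq z) a b : a != b -> tnth z a != tnth z b.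
  by move=> ab; apply: contra ab => /eqP /(tuple_uniqP _ uz) ->.
have := cxy (i, j, k); rewrite !ffunE /=.
have := gx _ _ _ (mem_tnth i x) (mem_tnth j x) (mem_tnth k x)
  (inj _ ux _ _ ij) (inj _ ux _ _ jk) (inj _ ux _ _ ik).
have := gy _ _ _ (mem_tnth i y) (mem_tnth j y) (mem_tnth k y)
  (inj _ uy _ _ ij) (inj _ uy _ _ jk) (inj _ uy _ _ ik).
case: (ltrgt0P (area (tnth x i) _ _)) => [h|h|->]; rewrite ?eqxx//;
  case: (ltrgt0P (area (tnth y i) _ _)) => [h'|h'|->]; rewrite ?eqxx// => _ _ _.
  by rewrite !gtr0_sg.
by rewrite !ltr0_sg.
Qed.

Lemma has_order_type_chirotope n (w : order_type R) (x y : n.-tuple T) :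
  generic x -> generic y -> chirotope x = chirotope y ->
  has_order_type w x -> has_order_type w y.
Proof.
move=> gx gy cxy [P [Px Pw]]; have [ux _] := gx; have [uy _] := gy.
have /asboolP gQ := (generic_general_position uy).1 gy.
pose Q := PointSet gQ; exists Q; split => //; rewrite -Pw.
apply/eqmodP/asboolP.
have inPE a : (a \in points P) = (a \in (x : seq T)) by rewrite Px inE.
have inQE a : (a \in points Q) = (a \in (y : seq T)) by rewrite inE.
have memP (p : points P) : val p \in (x : seq T) by rewrite -inPE; exact: valP.
have memQ (q : points Q) : val q \in (y : seq T) by rewrite -inQE; exact: valP.
have ltQ (q : points Q) : (index (val q) y < n)%N.
  by rewrite -[X in (_ < X)%N](size_tuple y) index_mem.
have ltP (p : points P) : (index (val p) x < n)%N.
  by rewrite -[X in (_ < X)%N](size_tuple x) index_mem.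
have inP i : tnth x i \in points P by rewrite inPE mem_tnth.
have inQ i : tnth y i \in points Q by rewrite inQE mem_tnth.
pose f (q : points Q) : points P := [` inP (Ordinal (ltQ q))]%fset.
pose g (p : points P) : points Q := [` inQ (Ordinal (ltP p))]%fset.
have tnth_index (z : n.-tuple T) p (h : (index p z < n)%N) : p \in (z : seq T) ->
    tnth z (Ordinal h) = p.
  by move=> pz; rewrite (tnth_nth p)/= nth_index.
have index_tnth (z : n.-tuple T) i : uniq z -> index (tnth z i) z = i.
  by move=> uz; rewrite (tnth_nth (tnth z i)) index_uniq// size_tuple.
exists f; split.
  exists g => [q|p]; apply: val_inj => /=.
    rewrite -[RHS](tnth_index _ _ (ltQ q) (memQ q)); congr tnth.
    by apply: val_inj; rewrite /= index_tnth.
  rewrite -[RHS](tnth_index _ _ (ltP p) (memP p)); congr tnth.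
  by apply: val_inj; rewrite /= index_tnth.
move=> p q r _ _ _ /=; rewrite (chirotope_area _ _ _ gx gy cxy).
by rewrite !(tnth_index _ _ (ltQ _) (memQ _)).
Qed.

Definition same_orientations (L : seq (T * T)) :=
  forall e1 e2 e3, e1 \in L -> e2 \in L -> e3 \in L ->
    orientation e1.1 e2.1 e3.1 = orientation e1.2 e2.2 e3.2.

(** The matching reorders both samples, which leaves the counts [hits] unchanged; besides
    orientations, these are all that is later kept of the samples. *)
Lemma has_order_type_matching n (w : order_type R) (x y : n.-tuple T) :
  generic x -> generic y -> has_order_type w x -> has_order_type w y ->
  exists2 L : seq (T * T), same_orientations L &
    perm_eq (map fst L) x /\ perm_eq (map snd L) y.
Proof.
move=> [ux _] [uy _] [P [Px Pw]] [Q [Qy Qw]].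
have /eqmodP/asboolP[f [bf fE]] : (P = Q %[mod order_type R])%qT by rewrite Pw Qw.
exists [seq (val p, val (f p)) | p <- enum {: points P}].
  move=> _ _ _ /mapP[p _ ->] /mapP[q _ ->] /mapP[r _ ->] /=.
  have [->|pq] := eqVneq p q; first by rewrite !orientationE !area_diagl.
  have [->|qr] := eqVneq q r; first by rewrite !orientationE !area_diagr.
  have [->|pr] := eqVneq p r; first by rewrite !orientationE !area_diag.
  by rewrite fE.
have inPE a : (a \in points P) = (a \in (x : seq T)) by rewrite Px inE.
have inQE a : (a \in points Q) = (a \in (y : seq T)) by rewrite Qy inE.
rewrite -!map_comp; split; apply: uniq_perm => //.
- by rewrite map_inj_uniq -?enumT ?enum_uniq// => p q /= /val_inj.
- move=> a; apply/mapP/idP => [[p _ ->]/=|ax].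
    by rewrite -inPE; exact: valP.
  have aP : a \in points P by rewrite inPE.
  by exists [` aP]%fset => //; rewrite mem_enum.
- by rewrite map_inj_uniq -?enumT ?enum_uniq// => p q /= /val_inj /(bij_inj bf).
move=> a; apply/mapP/idP => [[p _ ->]/=|ay].
  by rewrite -inQE; exact: valP.
have aQ : a \in points Q by rewrite inQE.
have [g fK gK] := bf.
exists (g [` aQ]%fset); first by rewrite -enumT mem_enum.
exact: (esym (congr1 val (gK [` aQ]%fset))).
Qed.

End OrderTypes.

(** * Samples of the two measures with a common order type *)

Section MatchedSamples.
Variable R : realType.
Notation T := (R * R)%type.

Lemma measurable_has_order_type n (w : order_type R) : order_type_size w = n ->
  measurable [set x : n.-tuple T | has_order_type w x].
Proof.
move=> sw.
pose C := [set c : {ffun 'I_n * 'I_n * 'I_n -> bool} | exists x : n.-tuple T,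
  [/\ generic x, has_order_type w x & chirotope x = c]].
rewrite (_ : [set x | _] = \bigcup_(c in C)
  ([set x : n.-tuple T | generic x] `&` [set x : n.-tuple T | chirotope x = c])).
  apply: fin_bigcup_measurable => // c _; apply: measurableI.
    exact: measurable_generic.
  exact: measurable_chirotope.
apply/seteqP; split=> [x /= wx|y [c [x [gx wx cx]] [/= gy cy]]].
  have gx := has_order_type_generic sw wx.
  by exists (chirotope x) => //; exists x.
by apply: has_order_type_chirotope wx => //; rewrite cx cy.
Qed.

Lemma ellE n (mu : probability (R * R)%type R) (w : order_type R) :
  order_type_size w = n ->
  ell mu w = iid mu n [set x : n.-tuple T | has_order_type w x].
Proof. by move=> sw; case: n / sw. Qed.

Variables mu1 mu2 : probability (R * R)%type R.
Hypothesis line_mu1 : forall L : set (R * R), is_line L -> mu1 L = 0%E.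
Hypothesis line_mu2 : forall L : set (R * R), is_line L -> mu2 L = 0%E.
Hypothesis ell_eq : ell mu1 = ell mu2.

(** Suppose that no order type is shared. The event [A] that the order type is one realised by a
    generic sample in [E1] then contains [E1] and misses [E2], up to null sets. As a finite disjoint
    union of order type classes, [A] has the same probability under both laws, so the two given
    probabilities add up to at most 1. *)
Lemma same_order_type_samples n (E1 E2 : set (n.-tuple T)) :
  measurable E1 -> measurable E2 -> (1 < iid mu1 n E1 + iid mu2 n E2)%E ->
  exists w x y, [/\ E1 x, E2 y, generic x, generic y &
    has_order_type w x /\ has_order_type w y].
Proof.
move=> mE1 mE2; apply: contraPP => none; apply/negP; rewrite -leNgt.
pose S := [set w : order_type R | exists x : n.-tuple T,
  [/\ E1 x, generic x & has_order_type w x]].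
pose D w := [set x : n.-tuple T | has_order_type w x].
have sizeS w : S w -> order_type_size w = n.
  move=> [x [_ gx wx]]; have [w' sw' w'x] := has_order_type_exists gx.
  by rewrite (has_order_type_inj wx w'x).
have finS : finite_set S.
  (* [h] sends a chirotope to the order type of the generic tuples that have it, and to [None] if
     there are none, so [S] inherits finiteness from the chirotopes. *)
  pose h (c : {ffun 'I_n * 'I_n * 'I_n -> bool}) : option (order_type R) :=
    if pselect (exists w, exists x : n.-tuple T,
      [/\ generic x, has_order_type w x & chirotope x = c]) is left e
    then Some (projT1 (cid e)) else None.
  apply: (@sub_finite_set _ _
      (Some @^-1` (h @` [set: {ffun 'I_n * 'I_n * 'I_n -> bool}]))).
    move=> w [x [_ gx wx]]; exists (chirotope x) => //.
    rewrite /h; case: pselect => [e|]; last by case; exists w, x.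
    congr Some; case: (cid e) => w' /= [y [gy wy cy]].
    apply: has_order_type_inj wx.
    exact: has_order_type_chirotope wy.
  by apply: finite_preimage; [move=> ? ? _ _ []|exact: finite_image].
have mD w : S w -> measurable (D w) by move=> /sizeS; exact: measurable_has_order_type.
have tD : trivIset S D.
  by move=> w w' _ _ [x [/= wx w'x]]; exact: has_order_type_inj wx w'x.
pose A := \bigcup_(w in S) D w.
have mA : measurable A by exact: fin_bigcup_measurable.
have eA : iid mu1 n A = iid mu2 n A.
  rewrite /A !measure_fin_bigcup//; apply: eq_fsbigr => w /set_mem Sw.
  have e (mu : probability (R * R)%type R) : iid mu n (D w) = ell mu w by rewrite (ellE mu (sizeS _ Sw)).
  by apply: (etrans (e mu1)); rewrite ell_eq -e.
pose G := [set t : n.-tuple T | generic t].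
have mG : measurable G by exact: measurable_generic.
have nullG (mu : probability (R * R)%type R) : iid mu n G = 1%E -> iid mu n (~` G) = 0%E.
  by move=> e; rewrite probability_setC// e subee.
have le1 : (iid mu1 n E1 <= iid mu1 n A)%E.
  rewrite -[leRHS]adde0 -(nullG _ (iid_generic line_mu1 n)).
  apply: le_trans (measureU2 _ mA (measurableC mG)).
  apply: le_measure; first exact/mem_set.
    by apply/mem_set; apply: (measurableU _ _ mA); exact: measurableC.
  move=> x E1x; have [gx|] := pselect (G x); last by right.
  by have [w sw wx] := has_order_type_exists gx; left; exists w => //; exists x.
have le2 : (iid mu2 n E2 <= iid mu2 n (~` A))%E.
  rewrite -[leRHS]adde0 -(nullG _ (iid_generic line_mu2 n)).
  apply: le_trans (measureU2 _ (measurableC mA) (measurableC mG)).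
  apply: le_measure; first exact/mem_set.
    by apply/mem_set; apply: measurableU; exact: measurableC.
  move=> y E2y; have [gy|] := pselect (G y); last by right.
  left => -[w [x [E1x gx wx]] wy]; apply: none.
  by exists w, x, y.
apply: (le_trans (leeD le1 le2)).
by rewrite probability_setC// eA addeC subeK// fin_num_measure.
Qed.

Definition deviates (mu : probability (R * R)%type R) (e : R) (B : set T) (s : seq T) :=
  e * (size s)%:R <= `|(hits B s)%:R - (size s)%:R * fine (mu B)|.

Lemma measurable_deviates n mu e B : measurable B ->
  measurable [set t : n.-tuple T | deviates mu e B t].
Proof.
move=> mB; rewrite /deviates.
under eq_set do rewrite size_tuple.
rewrite -[X in measurable X]setTI.
apply: (@measurable_fun_le _ _ _ _ (cst (e * n%:R)%R)) => //=.
apply: (measurableT_comp (@normr_measurable R setT)).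
by apply: measurable_funB => //; exact: measurable_hits.
Qed.

Lemma iid_exists_deviates n (mu : probability (R * R)%type R) (e : R) (I : eqType)
    (F : I -> set T) (s : seq I) : 0 < e -> (0 < n)%N -> (forall i, measurable (F i)) ->
  measurable [set t : n.-tuple T | exists2 i, i \in s & deviates mu e (F i) t] /\
  (iid mu n [set t : n.-tuple T | exists2 i, i \in s & deviates mu e (F i) t] <=
    ((size s)%:R * (e ^- 2 / n%:R))%:E)%E.
Proof.
move=> e0 n0 mF; elim: s => [|i s [mIH IH]].
  rewrite (_ : [set t | _] = set0) ?measure0 ?mul0r//.
  by apply/seteqP; split=> // t [].
rewrite (_ : [set t | _] = [set t : n.-tuple T | deviates mu e (F i) t] `|`
   [set t : n.-tuple T | exists2 i, i \in s & deviates mu e (F i) t]); last first.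
  apply/seteqP; split=> t /=.
    by move=> [j]; rewrite in_cons => /predU1P[->|js]; [left|right; exists j].
  move=> [di|[j js dj]]; first by exists i => //; rewrite mem_head.
  by exists j => //; rewrite in_cons js orbT.
have mi := @measurable_deviates n mu e _ (mF i).
split; first exact: measurableU.
apply: (le_trans (measureU2 _ mi mIH)).
rewrite /= -natr1 mulrDl mul1r addrC EFinD; apply: leeD => //.
have := hits_chebyshev mu (mF i) e0 n0; congr (_ <= _)%E; congr (iid mu n _).
by apply/seteqP; split=> t /=; rewrite /deviates size_tuple.
Qed.

Lemma matched_empirical_samples (I : eqType) (F : I -> set T) (s : seq I) (e : R) :
  0 < e -> (forall i, measurable (F i)) ->
  exists L : seq (T * T), [/\ (0 < size L)%N, same_orientations L,
    forall i, i \in s -> ~ deviates mu1 e (F i) (map fst L) &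
    forall i, i \in s -> ~ deviates mu2 e (F i) (map snd L)].
Proof.
(* For [n > K] the union bound leaves each measure a probability below 1/2 of a bad sample, so the
   probabilities of the two events of good samples add up to more than 1. *)
move=> e0 mF; pose K := (size s)%:R * e ^- 2 * 2 : R.
pose n := (Num.truncn K).+1; have nK : K < n%:R by exact: truncnS_gt.
have n0 : (0 < n)%N by [].
have [m1 p1] := iid_exists_deviates mu1 s e0 n0 mF.
have [m2 p2] := iid_exists_deviates mu2 s e0 n0 mF.
have half : (size s)%:R * (e ^- 2 / n%:R) < 2^-1.
  by rewrite mulrA ltr_pdivrMr ?ltr0n//; move: nK; rewrite /K; lra.
have [|w [x [y [Ex Ey gx gy [wx wy]]]]] :=
    same_order_type_samples (measurableC m1) (measurableC m2).
  rewrite !probability_setC//.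
  have f1 := fin_num_measure (iid mu1 n) _ m1.
  have f2 := fin_num_measure (iid mu2 n) _ m2.
  move: p1 p2; rewrite -(fineK f1) -(fineK f2) !lee_fin -!EFinB -EFinD lte_fin.
  by move=> p1 p2; lra.
have [L oL [L1 L2]] := has_order_type_matching gx gy wx wy.
exists L; split => //.
- by rewrite -(size_map fst) (perm_size L1) size_tuple.
- move=> i si; have := Ex; rewrite /deviates /hits (perm_size L1) (permP L1) => nd d.
  by apply: nd; exists i.
- move=> i si; have := Ey; rewrite /deviates /hits (perm_size L2) (permP L2) => nd d.
  by apply: nd; exists i.
Qed.

End MatchedSamples.

(** * Finitely additive couplings *)

Section RationalBoxes.
Variable R : realType.
Notation T := (R * R)%type.

Definition rbox := ((rat * rat) * (rat * rat))%type.

Definition open_rbox (q : rbox) : set T :=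
  [set p | (ratr q.1.1 < p.1 < ratr q.1.2) && (ratr q.2.1 < p.2 < ratr q.2.2)].

Definition closed_rbox (q : rbox) : set T :=
  `[ratr q.1.1, ratr q.1.2] `*` `[ratr q.2.1, ratr q.2.2].

(** Finite unions of rational boxes form a countable family that exhausts every open set from
    inside, so a sequence of samples can become accurate on all of them. *)
Definition rboxes (s : seq rbox) : set T := [set p | exists2 q, q \in s & open_rbox q p].

Lemma open_measurable_plane (O : set T) : open O -> measurable O.
Proof. by move=> oO; rewrite measurable_plane_borel; exact: sub_sigma_algebra. Qed.

Lemma closed_measurable_plane (C : set T) : closed C -> measurable C.
Proof.
by move=> cC; rewrite -[C]setCK; apply: measurableC; apply: open_measurable_plane;
  exact: closed_openC.
Qed.

Lemma open_open_rbox q : open (open_rbox q).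
Proof.
have -> : open_rbox q = fst @^-1` [set` `]ratr q.1.1, ratr q.1.2[] `&`
    snd @^-1` [set` `]ratr q.2.1, ratr q.2.2[].
  by apply/seteqP; split=> p /=; rewrite /open_rbox /= !in_itv /= => /andP.
by apply: openI; apply: open_comp; (try exact: interval_open) => // x _;
  [exact: cvg_fst|exact: cvg_snd].
Qed.

Lemma open_rboxes s : open (rboxes s).
Proof.
have -> : rboxes s = \bigcup_(q in [set` s]) open_rbox q by [].
by apply: bigcup_open => q _; exact: open_open_rbox.
Qed.

Lemma compact_closed_rbox q : compact (closed_rbox q).
Proof. by apply: compact_setX; exact: segment_compact. Qed.

Lemma compact_closed_rboxes (s : seq rbox) :
  compact [set p | exists2 q, q \in s & closed_rbox q p].
Proof.
elim: s => [|q s IH].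
  rewrite (_ : [set p | _] = set0); first exact: compact0.
  by apply/seteqP; split=> // p [].
rewrite (_ : [set p | _] =
    closed_rbox q `|` [set p | exists2 q, q \in s & closed_rbox q p]); last first.
  apply/seteqP; split=> p /=.
    by move=> [r]; rewrite in_cons => /predU1P[->|rs rp]; [left|right; exists r].
  move=> [qp|[r rs rp]]; first by exists q => //; rewrite mem_head.
  by exists r => //; rewrite in_cons rs orbT.
by apply: compactU => //; exact: compact_closed_rbox.
Qed.

Lemma open_closed_rbox q : open_rbox q `<=` closed_rbox q.
Proof.
move=> p /andP[/andP[h1 h2] /andP[h3 h4]].
by split; rewrite /= in_itv /= !ltW.
Qed.

Lemma open_rbox_nbhs (O : set T) p : open O -> O p ->
  exists2 q, open_rbox q p & closed_rbox q `<=` O.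
Proof.
move=> oO Op.
have /nbhs_ballP[e /= e0 eO] : nbhs p O by exact: open_nbhs_nbhs.
have H (z : R) : exists q : rat * rat, ratr q.1 < z < ratr q.2 /\
    forall t, ratr q.1 <= t <= ratr q.2 -> `|z - t| < e.
  have /rat_in_itvoo[a /itvP aE] : z - e < z by rewrite ltrBlDr ltrDl.
  have /rat_in_itvoo[b /itvP bE] : z < z + e by rewrite ltrDl.
  exists (a, b); split => /=; first by rewrite aE bE.
  move=> t /andP[at_ tb]; have : z - e < ratr a by rewrite aE.
  have : ratr b < z + e by rewrite bE.
  by rewrite ltr_norml; lra.
have [q1 [h1 H1]] := H p.1; have [q2 [h2 H2]] := H p.2.
exists (q1, q2); first by rewrite /open_rbox /= h1.
move=> t [/=]; rewrite !in_itv /= => t1 t2; apply: eO.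
by split; [exact: H1|exact: H2].
Qed.

(** Among the boxes with the first [k] codes, keep those whose closed box lies in [O]; the union of
    these closed boxes is the compact set in between. *)
Lemma open_exhaustion (O : set T) : open O -> exists s : nat -> seq rbox,
  [/\ nondecreasing_seq (rboxes \o s), \bigcup_k rboxes (s k) = O &
    forall k, exists2 C, compact C & rboxes (s k) `<=` C /\ C `<=` O].
Proof.
move=> oO.
pose s (k : nat) : seq rbox := [seq q <- pmap (@choice.unpickle rbox) (iota 0 k) | `[< closed_rbox q `<=` O >]].
have sE (k : nat) (q : rbox) : q \in s k <->
    closed_rbox q `<=` O /\ exists2 i, (i < k)%N & choice.unpickle i = Some q.
  rewrite mem_filter mem_pmap; split=> [/andP[/asboolP qO /mapP[i]]|[qO [i ik iq]]].
    by rewrite mem_iota add0n => /andP[_ ik] iq; split=> //; exists i.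
  apply/andP; split; first exact/asboolP.
  by apply/mapP; exists i; rewrite ?mem_iota.
exists s; split.
- move=> m n mn; apply/subsetPset => p [q /sE[qO [i im iq]] qp].
  by exists q => //; apply/sE; split=> //; exists i => //; exact: leq_trans mn.
- apply/seteqP; split=> [p [k _ [q /sE[qO _]] qp]|p Op].
    exact/qO/open_closed_rbox.
  have [q qp qO] := open_rbox_nbhs oO Op.
  exists (choice.pickle q).+1 => //; exists q => //; apply/sE; split=> //.
  by exists (choice.pickle q) => //; rewrite choice.pickleK.
move=> k; exists [set p | exists2 q, q \in s k & closed_rbox q p].
  exact: compact_closed_rboxes.
split; first by move=> p [q qs qp]; exists q => //; exact: open_closed_rbox.
by move=> p [q /= /sE[qO _]]; exact: qO.
Qed.

(** Continuity from below along an exhaustion. The intermediate compact set [C] is kept because null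
    sets of a coupling will be detected on compact sets. *)
Lemma measure_open_le (mu : {measure set (R * R)%type -> \bar R}) (O : set T) (c : \bar R) :
  open O -> (forall s C, compact C -> rboxes s `<=` C -> C `<=` O -> (mu (rboxes s) <= c)%E) ->
  (mu O <= c)%E.
Proof.
move=> oO H; have [s [nds sO sC]] := open_exhaustion oO.
have ms k : measurable (rboxes (s k)).
  by apply: open_measurable_plane; exact: open_rboxes.
have : mu \o (rboxes \o s) @ \oo --> mu O.
  rewrite -sO; apply: nondecreasing_cvg_mu => //.
  by rewrite sO; exact: open_measurable_plane.
move=> /cvge_to_le; apply; apply: nearW => k /=.
by have [C cC [sub1 sub2]] := sC k; exact: H sub2.
Qed.

End RationalBoxes.

(* [P] is a finitely additive probability defined on all sets of pairs of points;
   its marginals need only dominate [mu1] and [mu2] on open sets. *)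
Record order_coupling (R : realType) (mu1 mu2 : probability (R * R)%type R)
    (P : set ((R * R) * (R * R)) -> R) : Prop := OrderCoupling {
  coupling_ge0 : forall E, 0 <= P E;
  coupling_le : forall E F, E `<=` F -> P E <= P F;
  couplingU : forall E F, P (E `|` F) <= P E + P F;
  couplingC : forall E, P E + P (~` E) = 1;
  coupling_fst : forall O, open O -> (mu1 O <= (P (fst @^-1` O))%:E)%E;
  coupling_snd : forall O, open O -> (mu2 O <= (P (snd @^-1` O))%:E)%E;
  coupling_orientation : forall E1 E2 E3, 0 < P E1 -> 0 < P E2 -> 0 < P E3 ->
    exists e1 e2 e3, [/\ E1 e1, E2 e2, E3 e3 &
      orientation e1.1 e2.1 e3.1 = orientation e1.2 e2.2 e3.2] }.

Lemma ultra_fmap (S V : Type) (f : S -> V) (F : set_system S) :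
  UltraFilter F -> UltraFilter (f @ F).
Proof.
move=> UF; split => [|H HF sub]; first exact: fmap_proper_filter.
apply/seteqP; split=> // B HB; have [//|nB] := in_ultra_setVsetC (f @^-1` B) UF.
have HnB : H (~` B) by apply: sub.
by have [x [? ?]] := filter_ex (filterI HB HnB).
Qed.

Section ExistsCoupling.
Variable R : realType.
Notation T := (R * R)%type.
Variables mu1 mu2 : probability (R * R)%type R.
Hypothesis line_mu1 : forall L : set (R * R), is_line L -> mu1 L = 0%E.
Hypothesis line_mu2 : forall L : set (R * R), is_line L -> mu2 L = 0%E.
Hypothesis ell_eq : ell mu1 = ell mu2.

(** [P E] is the ultralimit of the proportion of matched pairs that lie in [E]. *)
Lemma exists_order_coupling : exists P, order_coupling mu1 mu2 P.
Proof.
(* The sample of index [n] is accurate to [1 / (n + 1)] on the families of boxes whose code is below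
   [n], so each family is eventually controlled. *)
pose codes n : seq (seq rbox) := pmap (@choice.unpickle (seq rbox)) (iota 0 n).
have mF (s : seq rbox) : measurable (@rboxes R s).
  by apply: open_measurable_plane; exact: open_rboxes.
have /choice[L HL] : forall n : nat, exists L : seq (T * T),
  [/\ (0 < size L)%N, same_orientations L,
    forall i, i \in codes n -> ~ deviates mu1 n.+1%:R^-1 (rboxes i) (map fst L) &
    forall i, i \in codes n -> ~ deviates mu2 n.+1%:R^-1 (rboxes i) (map snd L)].
  by move=> n; apply: matched_empirical_samples => //; rewrite invr_gt0 ltr0n.
(* An ultrafilter finer than [\oo] makes every sequence in [[0, 1]] converge, so [P] is defined on
   arbitrary subsets. *)
have [G [UG subG]] := @ultraFilterLemma nat \oo _.
have PG : ProperFilter G by exact: ultra_proper.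
pose freq E n : R := (hits E (L n))%:R / (size (L n))%:R.
have sL n : 0 < (size (L n))%:R :> R by rewrite ltr0n; case: (HL n).
have freq01 E n : 0 <= freq E n <= 1.
  rewrite /freq divr_ge0// ler_pdivrMr// mul1r ler_nat.
  exact: count_size.
have cvgP E : exists l : R, freq E n @[n --> G] --> l.
  have := @segment_compact R 0 1; rewrite compact_ultra /=.
  move=> /(_ (freq E n @[n --> G]) (@ultra_fmap _ _ (fun n => freq E n) G UG)) [|l [_ cl]]; last by exists l.
  by apply: nearW => n; rewrite /= in_itv /= freq01.
pose P E : R := projT1 (cid (cvgP E)).
have PE E : freq E n @[n --> G] --> P E by exact: (projT2 (cid (cvgP E))).
have P_uniq E (l : R) : freq E n @[n --> G] --> l -> P E = l.
  by move=> c; apply: cvg_unique (PE E) c.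
have Ple E F : E `<=` F -> P E <= P F.
  move=> EF; apply: (ler_cvg_to (PE E) (PE F)); apply: nearW => n.
  rewrite ler_pM2r ?invr_gt0// ler_nat; apply: sub_count => e /asboolP Ee.
  exact/asboolP/EF.
have marginal (mu : probability T R) (pr : T * T -> T) : (forall n i, i \in codes n ->
    ~ deviates mu n.+1%:R^-1 (rboxes i) (map pr (L n))) ->
    forall s, P (pr @^-1` (rboxes s)) = fine (mu (rboxes s)).
  move=> H s; apply: P_uniq.
  apply: (@cvg_trans _ (freq (pr @^-1` rboxes s) n @[n --> \oo])).
    by move=> B; exact: subG.
  apply/cvgrPdist_lt => e e0.
  near=> n.
  have : s \in codes n.
    rewrite mem_pmap; apply/mapP; exists (choice.pickle s).
      by rewrite mem_iota add0n/=; near: n; exact: nbhs_infty_gt.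
    by rewrite choice.pickleK.
  move=> /H /negP; rewrite -ltNge size_map /hits count_map => h.
  have {}h : `|freq (pr @^-1` rboxes s) n - fine (mu (rboxes s))| < n.+1%:R^-1.
    rewrite -(ltr_pM2r (sL n)); apply: le_lt_trans h.
    rewrite -[X in _ * X](@gtr0_norm _ (size (L n))%:R)// -normrM mulrBl /freq.
    by rewrite divfK ?gt_eqF// [X in _ - X]mulrC.
  rewrite distrC (lt_trans h)//.
  by near: n; exact: near_infty_natSinv_lt (PosNum e0).
(* The marginals are exact on finite unions of boxes; on an open set, exhaustion from inside gives
   one inequality. *)
have ge (mu : probability T R) (pr : T * T -> T) :
    (forall s, P (pr @^-1` (rboxes s)) = fine (mu (rboxes s))) ->
    forall O, open O -> (mu O <= (P (pr @^-1` O))%:E)%E.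
  move=> H O oO; apply: measure_open_le => // s C _ sC CO.
  rewrite -[leLHS]fineK ?fin_num_measure// -H lee_fin; apply: Ple.
  by move=> e /sC /CO.
exists P; split => //.
- move=> E; apply: (cvgr_to_ge (PE E)); apply: nearW => n.
  by case/andP: (freq01 E n).
- move=> E F; apply: (ler_cvg_to (PE _) (cvgD (PE E) (PE F))); apply: nearW => n.
  rewrite -[leRHS]/(freq E n + freq F n) /freq -mulrDl ler_pM2r ?invr_gt0// -natrD ler_nat /hits -count_predUI.
  apply: leq_trans (leq_addr _ _); apply: sub_count => e /asboolP.
  by move=> [Ee|Fe]; apply/orP; [left|right]; exact/asboolP.
- move=> E; apply: (@cvg_unique _ _ (fmap (fun n => freq E n + freq (~` E) n) G)) => //.
    by apply: cvgD; exact: PE.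
  rewrite (_ : (fun n => _) = cst 1); first exact: cvg_cst.
  apply/funext => n; rewrite /freq -mulrDl -natrD.
  rewrite (_ : (_ + _)%N = size (L n)) ?divff ?gt_eqF//.
  rewrite /hits -(count_predC (fun e => `[< E e >])); congr addn.
  by apply: eq_count => e /=; rewrite asbool_neg.
- apply: (ge mu1 fst) => s; apply: (marginal mu1 fst).
  by move=> n i; case: (HL n) => _ _ + _; apply.
- apply: (ge mu2 snd) => s; apply: (marginal mu2 snd).
  by move=> n i; case: (HL n) => _ _ _; apply.
move=> E1 E2 E3 p1 p2 p3.
(* A positive limit means that some pair of [L n] lies in [E] for [G]-most [n]; three such
   conditions hold at a common [n], so the three pairs come from one matching. *)
have near_pos E : 0 < P E -> \forall n \near G, exists2 e, e \in L n & E e.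
  move=> p; have : \forall n \near G, 0 < freq E n by exact: (cvgr_gt (P E)).
  apply: filterS => n.
  rewrite /freq pmulr_lgt0 ?invr_gt0// ltr0n -has_count => /hasP[e eL /asboolP].
  by exists e.
have [n [[e1 L1 h1] [[e2 L2 h2] [e3 L3 h3]]]] :=
  filter_ex (filterI (near_pos _ p1) (filterI (near_pos _ p2) (near_pos _ p3))).
exists e1, e2, e3; split => //.
by case: (HL n) => _ + _ _; apply.
Unshelve. all: by end_near.
Qed.

End ExistsCoupling.

Lemma cvg_fst_comp (U V : topologicalType) (S : Type) (F : set_system S)
    (k : S -> (U * V)%type) (e : (U * V)%type) :
  k @ F --> e -> (k x).1 @[x --> F] --> e.1.
Proof. by move=> ke; exact: (cvg_comp _ _ ke (@cvg_fst _ _ (nbhs e.1) (nbhs e.2) _)). Qed.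

Lemma cvg_snd_comp (U V : topologicalType) (S : Type) (F : set_system S)
    (k : S -> (U * V)%type) (e : (U * V)%type) :
  k @ F --> e -> (k x).2 @[x --> F] --> e.2.
Proof. by move=> ke; exact: (cvg_comp _ _ ke (@cvg_snd _ _ (nbhs e.1) (nbhs e.2) _)). Qed.

Lemma cvg_area (R : realType) (S : Type) (F : set_system S) (FF : Filter F)
    (f g h : S -> (R * R)%type) (p q r : (R * R)%type) :
  f @ F --> p -> g @ F --> q -> h @ F --> r ->
  area (f x) (g x) (h x) @[x --> F] --> area p q r.
Proof.
move=> fp gq hr.
by apply: cvgB; apply: cvgM; apply: cvgB; (try exact: cvg_fst_comp); exact: cvg_snd_comp.
Qed.

(** * Supports of probability measures on the plane *)

Section Support.
Variable R : realType.
Notation T := (R * R)%type.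

Lemma closed_line (L : set (R * R)) : is_line L -> closed L.
Proof.
move=> [a [b [c [_ ->]]]].
rewrite (_ : [set p | _] = (fun p : T => a * p.1 + b * p.2) @^-1` [set c])//.
apply: closed_comp => [p _|]; last exact: closed_eq.
apply: cvgD; apply: cvgM; (try exact: cvg_cst); [exact: cvg_fst|exact: cvg_snd].
Qed.

(** A point off the support has a null neighbourhood, hence a null rational box around it; there are
    countably many such boxes. *)
Lemma msupport_full (mu : probability (R * R)%type R) : mu.-negligible (~` msupport mu).
Proof.
pose F k := [set p : T | exists2 q, choice.unpickle k = Some q &
  mu (@open_rbox R q) = 0%E /\ open_rbox q p].
apply: (@negligibleS _ _ _ mu (\bigcup_k F k)).
  move=> p /= /existsNP[U] /not_implyP[oU] /not_implyP[Up] /negP.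
  rewrite -leNgt => mU.
  have [q qp qU] := open_rbox_nbhs oU Up.
  exists (choice.pickle q) => //; exists q; rewrite ?choice.pickleK//; split=> //.
  apply/eqP; rewrite eq_le measure_ge0 andbT; apply: le_trans mU.
  apply: le_measure.
  - by apply/mem_set; apply: open_measurable_plane; exact: open_open_rbox.
  - by apply/mem_set; exact: open_measurable_plane.
  exact: (subset_trans (@open_closed_rbox R q)).
apply: negligible_bigcup => k.
have [[q [e m0]]|none] := pselect (exists q, choice.unpickle k = Some q /\ mu (@open_rbox R q) = 0%E).
  apply: negligibleS (_ : mu.-negligible (@open_rbox R q)).
    by move=> p [q']; rewrite e => -[<-] [].
  by apply/negligibleP => //; apply: open_measurable_plane; exact: open_open_rbox.
apply: negligibleS (@negligible_set0 _ _ _ mu) => p [q e [m0 _]].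
by apply: none; exists q.
Qed.

(** Coupling inequalities concern open sets while cluster points need compact ones; an open square
    of full measure inside a closed square provides both. *)
Lemma compact_msupport_box (mu : probability (R * R)%type R) : compact (msupport mu) ->
  exists O C : set (R * R), [/\ open O, compact C, O `<=` C & mu O = 1%E].
Proof.
move=> cS.
have [M [_ HM]] := compact_bounded cS.
(* [HM] bounds the support by numbers strictly above [M], hence the first [+ 1]; the second one puts
   the support strictly inside the open square. *)
pose m := M + 1; have hm := HM m.
pose O : set T := fst @^-1` `](- (m + 1)), (m + 1)[ `&` snd @^-1` `](- (m + 1)), (m + 1)[.
exists O, (`[- (m + 1), m + 1] `*` `[- (m + 1), m + 1]).
have oO : open O.
  by apply: openI; apply: open_comp; (try exact: interval_open) => // x _;
    [exact: cvg_fst|exact: cvg_snd].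
split=> //.
- by apply: compact_setX; exact: segment_compact.
- by move=> p []; rewrite /= !in_itv /= => /andP[? ?] /andP[? ?]; split; rewrite /= ?in_itv /= !ltW.
have mO : measurable O by exact: open_measurable_plane.
have : mu.-negligible (~` O).
  apply: negligibleS (msupport_full mu); apply: subsetC => p Sp.
  have : `|p| <= m by apply: hm => //; rewrite ltrDl.
  rewrite prod_normE ge_max => /andP[]; rewrite !ler_norml => /andP[? ?] /andP[? ?].
  by split; rewrite /= in_itv /=; apply/andP; split; lra.
move=> /(measure_negligible (measurableC mO)) m0.
have : mu (~` O) = 0%E by exact: m0.
rewrite probability_setC//.
have fO := fin_num_measure mu _ mO.
by rewrite -(fineK fO) -EFinB => /eqP; rewrite eqe subr_eq0 => /eqP <-.
Qed.

End Support.

(** * The support of a coupling *)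

Section Coupling.
Variable R : realType.
Notation T := (R * R)%type.
Variables mu1 mu2 : probability (R * R)%type R.
Variable P : set (T * T) -> R.
Hypothesis cP : order_coupling mu1 mu2 P.

Definition coupling_support (Q : set (T * T) -> R) : set (T * T) :=
  [set e | forall N, nbhs e N -> 0 < Q N].
Local Notation K := (coupling_support P).

Lemma coupling_support_closed e : ~ K e -> \forall e' \near e, ~ K e'.
Proof.
move=> /existsNP[N] /not_implyP[Ne nP].
apply: filterS (nbhs_interior Ne) => e' Ne' Ke'.
exact/nP/Ke'.
Qed.

Lemma coupling_set0 : P set0 = 0.
Proof.
have := coupling_fst cP openT; rewrite probability_setT lee_fin preimage_setT => h.
have := couplingC cP set0; rewrite setC0 => e.
by apply/eqP; rewrite eq_le (coupling_ge0 cP) andbT; lra.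
Qed.

Lemma coupling_sub0 E F : E `<=` F -> P F = 0 -> P E = 0.
Proof.
move=> EF F0; apply/eqP; rewrite eq_le (coupling_ge0 cP) andbT -F0.
exact: coupling_le cP _ _ EF.
Qed.

Lemma couplingU0 E F : P E = 0 -> P F = 0 -> P (E `|` F) = 0.
Proof.
move=> E0 F0; apply/eqP; rewrite eq_le (coupling_ge0 cP) andbT.
by have := couplingU cP E F; rewrite E0 F0 addr0.
Qed.

(* The sets [A] with [P (C `\` A) = 0] form a filter; if [P C > 0], it has a
   cluster point in [C], and every cluster point lies in the support. *)
Lemma coupling_compact_null C : compact C -> (forall e, C e -> ~ K e) -> P C = 0.
Proof.
move=> cC CK; apply: contrapT => PC.
pose F := [set A : set (T * T) | P (C `\` A) = 0].
have FF : ProperFilter F.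
  apply: Build_ProperFilter_ex => [A FA|].
    apply: contrapT => nA; apply: PC; apply: coupling_sub0 FA => e Ce.
    by split=> // Ae; apply: nA; exists e.
  split=> [|A B FA FB|A B AB FA].
  - by rewrite /F/= setDT; exact: coupling_set0.
  - by rewrite /F/= setDIr; exact: couplingU0.
  - by apply: coupling_sub0 FA; exact: setDS.
have FC : F C by rewrite /F/= setDv; exact: coupling_set0.
have [e [Ce ce]] := cC F FF FC.
apply: (CK _ Ce) => N Ne; rewrite lt_neqAle (coupling_ge0 cP) andbT.
apply/negP => /eqP PN.
have FN : F (~` N) by apply: (coupling_sub0 _ (esym PN)) => x [_ /contrapT].
by have [x []] := ce _ _ FN Ne.
Qed.

(** Opposite signs would persist on neighbourhoods of the three points, all of positive mass, where
    the coupling provides a triple with equal orientations. *)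
Lemma coupling_support_area e1 e2 e3 : K e1 -> K e2 -> K e3 ->
  0 <= area e1.1 e2.1 e3.1 * area e1.2 e2.2 e3.2.
Proof.
move=> K1 K2 K3; rewrite leNgt; apply/negP => neg.
pose W := ((T * T) * (T * T) * (T * T))%type.
have c : area w.1.1.1 w.1.2.1 w.2.1 * area w.1.1.2 w.1.2.2 w.2.2 @[w --> ((e1, e2, e3) : W)]
    --> area e1.1 e2.1 e3.1 * area e1.2 e2.2 e3.2.
  have c1 : (fun w : W => w.1.1) @ ((e1, e2, e3) : W) --> e1.
    by apply: (@cvg_fst_comp _ _ _ _ _ (e1, e2)); exact: (@cvg_fst_comp _ _ _ _ _ (e1, e2, e3)).
  have c2 : (fun w : W => w.1.2) @ ((e1, e2, e3) : W) --> e2.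
    by apply: (@cvg_snd_comp _ _ _ _ _ (e1, e2)); exact: (@cvg_fst_comp _ _ _ _ _ (e1, e2, e3)).
  have c3 : (fun w : W => w.2) @ ((e1, e2, e3) : W) --> e3.
    exact: (@cvg_snd_comp _ _ _ _ _ (e1, e2, e3)).
  by apply: cvgM; apply: cvg_area;
    (try exact: (cvg_fst_comp c1)); (try exact: (cvg_fst_comp c2));
    (try exact: (cvg_fst_comp c3)); (try exact: (cvg_snd_comp c1));
    (try exact: (cvg_snd_comp c2)); exact: (cvg_snd_comp c3).
have [[N12 N3] /= [[[N1 N2] /= [n1 n2] sub12] n3] sub] := cvgr_lt _ c _ neg.
have [x1 [x2 [x3 [h1 h2 h3]]]] := coupling_orientation cP (K1 _ n1) (K2 _ n2) (K3 _ n3).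
rewrite !orientationE => sg.
have /= := sub (x1, x2, x3) (conj (sub12 (x1, x2) (conj h1 h2)) h3).
apply/negP; rewrite -leNgt -sgr_ge0 sgrM sg -expr2 sqr_ge0//.
Qed.

(** If all points of [K] over [C] had first coordinate in [L], the product of [C] with any compact
    set off [L] would be null. The mass over [C] would then be missing from the complement of [L],
    which has measure 1. *)
Lemma coupling_support_avoid (C L : set (R * R)) : compact C -> closed L ->
  mu1 L = 0%E -> 0 < P (snd @^-1` C) ->
  exists e, [/\ K e, C e.2 & ~ L e.1].
Proof.
move=> cC cL L0 PC; apply: contrapT => none.
have : (mu1 (~` L) <= (1 - P (snd @^-1` C))%:E)%E.
  apply: measure_open_le; first exact: closed_openC.
  move=> s D cD sD DL.
  have D0 : P (D `*` C) = 0.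
    apply: coupling_compact_null; first exact: compact_setX.
    by move=> e [De Ce] Ke; apply: none; exists e; split=> //; exact: DL.
  have h := coupling_fst cP (@open_rboxes R s); apply: (le_trans h); rewrite lee_fin.
  rewrite lerBrDr -(couplingC cP (fst @^-1` rboxes s)) lerD2l.
  have : snd @^-1` C `<=` D `*` C `|` ~` (fst @^-1` rboxes s).
    move=> e /= Ce; have [se|nse] := pselect (rboxes s e.1); last by right.
    by left; split => //; exact: sD.
  move=> /(coupling_le cP) /le_trans; apply.
  by apply: (le_trans (couplingU cP _ _)); rewrite D0 add0r.
rewrite probability_setC ?L0 ?sube0 ?lee_fin; first by lra.
exact: closed_measurable_plane.
Qed.

Lemma coupling_fst_support x N : msupport mu1 x -> nbhs x N -> 0 < P (fst @^-1` N).
Proof.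
move=> Sx /nbhs_interior Nx.
have : (0 < mu1 N°)%E by apply: Sx; [exact: open_interior|exact: nbhs_singleton].
move=> /lt_le_trans /(_ (coupling_fst cP (@open_interior _ N))); rewrite lte_fin.
move=> /lt_le_trans; apply; apply: (coupling_le cP) => e /=.
exact: interior_subset.
Qed.

Lemma coupling_snd_support y N : msupport mu2 y -> nbhs y N -> 0 < P (snd @^-1` N).
Proof.
move=> Sy /nbhs_interior Ny.
have : (0 < mu2 N°)%E by apply: Sy; [exact: open_interior|exact: nbhs_singleton].
move=> /lt_le_trans /(_ (coupling_snd cP (@open_interior _ N))); rewrite lte_fin.
move=> /lt_le_trans; apply; apply: (coupling_le cP) => e /=.
exact: interior_subset.
Qed.

(** Otherwise some [a], [b] in the interior of the support of [mu2] see [y] and [y'] on opposite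
    sides. Points of [K] whose second coordinates are near [a] and [b] can be chosen with first
    coordinates not collinear with [x]; the sign conditions for [y] and [y'] are then
    incompatible. *)
Lemma coupling_support_fun x y y' :
  (forall L : set (R * R), is_line L -> mu1 L = 0%E) ->
  (msupport mu2)° !=set0 -> K (x, y) -> K (x, y') -> y = y'.
Proof.
move=> line0 V0 Ky Ky'.
apply: (area_separation (@open_interior _ (msupport mu2)) V0) => a b Va Vb.
rewrite leNgt; apply/negP => neg.
have c : area w.1 w.2 y * area w.1 w.2 y' @[w --> ((a, b) : T * T)]
    --> area a b y * area a b y'.
  by apply: cvgM; apply: cvg_area; (try exact: cvg_cst); (try exact: cvg_fst); exact: cvg_snd.
have [[A B] /= [nA nB] sub] := cvgr_lt _ c _ neg.
have box N z : msupport mu2 z -> nbhs z N ->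
    exists C, [/\ compact C, 0 < P (snd @^-1` C) & C `<=` N].
  move=> Sz Nz; have [q qz qN] := open_rbox_nbhs (@open_interior _ N) (nbhs_singleton (nbhs_interior Nz)).
  exists (closed_rbox q); split.
  - exact: compact_closed_rbox.
  - apply: (coupling_snd_support Sz); apply: filterS (@open_closed_rbox R q) _.
    by apply: open_nbhs_nbhs; split=> //; exact: open_open_rbox.
  - exact: subset_trans qN (@interior_subset _ _).
have [C [cC PC CA]] := box _ _ (interior_subset Va) nA.
have [D [cD PD DB]] := box _ _ (interior_subset Vb) nB.
have avoid (L E : set (R * R)) : is_line L -> compact E -> 0 < P (snd @^-1` E) ->
    exists e, [/\ K e, E e.2 & ~ L e.1].
  move=> lL cE PE; apply: coupling_support_avoid => //; first exact: closed_line.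
  exact: line0.
have lx : is_line [set p : T | p.1 = x.1].
  exists 1, 0, x.1; split; first by apply/eqP => -[/eqP]; rewrite oner_eq0.
  by apply/seteqP; split=> p /= e; lra.
have [a1 [Ka1 Ca1 na1]] := avoid _ _ lx cC PC.
have a1x : a1.1 != x by apply/eqP => e; apply: na1; rewrite /= e.
have [b1 [Kb1 Db1 nb1]] := avoid _ _ (is_line_area a1x) cD PD.
have h : area b1.1 a1.1 x != 0 by apply/eqP.
have := coupling_support_area Kb1 Ka1 Ky; have := coupling_support_area Kb1 Ka1 Ky'.
have := sub (a1.2, b1.2) (conj (CA _ Ca1) (DB _ Db1)) => /=.
rewrite (area_swap a1.2) (area_swap a1.2 b1.2 y') mulrNN.
move: h; set u := area b1.1 a1.1 x; set v := area b1.2 _ y; set v' := area b1.2 _ y'.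
move=> u0 vv' uv uv'; have := mulr_ge0 uv uv'.
rewrite (_ : u * _ * _ = u ^+ 2 * (v * v')); last by ring.
by rewrite pmulr_rge0 ?exprn_even_gt0//= leNgt vv'.
Qed.

(** A fibrewise form of the argument for [coupling_compact_null]: the filter consists of the sets
    [A] such that, over some neighbourhood of [x], no mass lies in [C] outside [A]. It is proper
    because neighbourhoods of [x] carry mass, and its cluster points in [C] are partners of [x]. *)
Lemma coupling_support_exists x (O C : set (R * R)) :
  open O -> compact C -> O `<=` C -> mu2 O = 1%E ->
  msupport mu1 x -> exists y, K (x, y).
Proof.
move=> oO cC OC O1 Sx.
have C0 : P (~` (snd @^-1` C)) = 0.
  have : 1 <= P (snd @^-1` C).
    rewrite -lee_fin -O1; apply: (le_trans (coupling_snd cP oO)); rewrite lee_fin.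
    by apply: (coupling_le cP) => e /=; exact: OC.
  have := couplingC cP (snd @^-1` C) => e h.
  by apply/eqP; rewrite eq_le (coupling_ge0 cP) andbT; lra.
pose F := [set A : set T | exists2 N, nbhs x N & P (fst @^-1` N `&` snd @^-1` (C `\` A)) = 0].
have FF : ProperFilter F.
  apply: Build_ProperFilter_ex => [A [N Nx NA]|].
    apply: contrapT => nA.
    have := coupling_fst_support Sx Nx; apply/negP; rewrite -leNgt.
    rewrite -(couplingU0 NA C0); apply: (coupling_le cP) => e /= Ne.
    have [Ce|] := pselect (C e.2); last by right.
    by left; split=> //; split=> // Ae; apply: nA; exists e.2.
  split=> [|A B [N Nx NA] [N' Nx' NB]|A B AB [N Nx NA]].
  - exists setT; first exact: filterT.
    by rewrite setDT preimage_set0 setI0; exact: coupling_set0.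
  - exists (N `&` N'); first exact: filterI.
    apply: coupling_sub0 (couplingU0 NA NB) => e [[Ne Ne'] [Ce nAB]].
    have [Ae|] := pselect (A e.2); last by left.
    by right; split=> //; split=> // Be; exact: nAB.
  - exists N => //; apply: coupling_sub0 NA => e [Ne [Ce nBe]].
    by split=> //; split=> // /AB.
have FC : F C.
  exists setT; first exact: filterT.
  by rewrite setDv preimage_set0 setI0; exact: coupling_set0.
have [y [Cy cy]] := cC F FF FC.
exists y => N [[N1 N2] /= [n1 n2] sub].
rewrite lt_neqAle (coupling_ge0 cP) andbT; apply/negP => /eqP PN.
have FN : F (~` N2).
  exists N1 => //; apply: (coupling_sub0 _ (esym PN)) => e [N1e [_ /contrapT N2e]].
  exact: sub.
by have [z []] := cy _ _ FN n2.
Qed.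

Lemma coupling_support_snd (O C : set (R * R)) x y :
  open O -> compact C -> O `<=` C -> mu2 O = 1%E -> K (x, y) -> C y.
Proof.
move=> oO cC OC O1 Kxy; apply: contrapT => nCy.
have cl : closed C by apply: compact_closed => //; exact: norm_hausdorff.
have /Kxy : nbhs (x, y) (snd @^-1` (~` C)).
  apply: open_nbhs_nbhs; split=> //; apply: open_comp; last exact: closed_openC.
  by move=> e _; exact: cvg_snd.
have : 1 <= P (snd @^-1` C).
  rewrite -lee_fin -O1; apply: (le_trans (coupling_snd cP oO)); rewrite lee_fin.
  by apply: (coupling_le cP) => e /=; exact: OC.
by have := couplingC cP (snd @^-1` C); rewrite preimage_setC; lra.
Qed.

End Coupling.

Lemma order_coupling_swap (R : realType) (mu1 mu2 : probability (R * R)%type R) P :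
  order_coupling mu1 mu2 P ->
  order_coupling mu2 mu1 (fun E => P [set e | E (e.2, e.1)]).
Proof.
move=> cP; split.
- by move=> E; exact: coupling_ge0 cP _.
- by move=> E F EF; apply: (coupling_le cP) => e /=; exact: EF.
- by move=> E F; exact: couplingU cP _ _.
- by move=> E; exact: couplingC cP _.
- by move=> O oO; exact: (coupling_snd cP oO).
- by move=> O oO; exact: (coupling_fst cP oO).
move=> E1 E2 E3 p1 p2 p3.
have [e1 [e2 [e3 [h1 h2 h3 o]]]] := coupling_orientation cP p1 p2 p3.
by exists (e1.2, e1.1), (e2.2, e2.1), (e3.2, e3.1).
Qed.

Lemma coupling_support_swap (R : realType) (P : set ((R * R) * (R * R)) -> R) x y :
  coupling_support P (x, y) ->
  coupling_support (fun E => P [set e | E (e.2, e.1)]) (y, x).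
Proof.
move=> Kxy N [[N1 N2] /= [n1 n2] sub]; apply: Kxy.
by exists (N2, N1) => //= e [e2 e1]; exact: sub.
Qed.

(** * The local fundamental theorem of projective geometry *)

(** Subtract the linear function that agrees with [g] at [z = d / 2]. The difference [h] vanishes at
    every [z / 2 ^+ n], hence is unchanged by these translations; a value of [h] is thus its value
    at an arbitrarily small remainder, which continuity at 0 makes small. *)
Lemma locally_additive_linear (R : realType) (g : R -> R) (d : R) : 0 < d ->
  (forall x y, `|x| < d -> `|y| < d -> `|x + y| < d -> g (x + y) = g x + g y) ->
  g x @[x --> 0] --> g 0 -> exists k, forall x, `|x| < d -> g x = k * x.
Proof.
move=> d0 add cg.
have g0 : g 0 = 0 by have := add 0 0; rewrite addr0 normr0 => /(_ d0 d0 d0); lra.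
pose z := d / 2; have z0 : 0 < z by rewrite divr_gt0.
have zd : z < d by rewrite ltr_pdivrMr// ltr_pMr// ltr1n.
pose h x := g x - g z / z * x.
have hadd x y : `|x| < d -> `|y| < d -> `|x + y| < d -> h (x + y) = h x + h y.
  by move=> xd yd xyd; rewrite /h add//; ring.
have hz n : h (z / 2 ^+ n) = 0.
  elim: n => [|n IH]; first by rewrite expr0 divr1 /h divfK ?subrr ?gt_eqF.
  have e : z / 2 ^+ n.+1 + z / 2 ^+ n.+1 = z / 2 ^+ n by rewrite exprS; field; rewrite expf_neq0.
  have lt m : `|z / 2 ^+ m| < d.
    rewrite gtr0_norm ?divr_gt0 ?exprn_gt0// ltr_pdivrMr ?exprn_gt0//.
    by rewrite (lt_le_trans zd)// ler_peMr ?(ltW d0)// exprn_ege1// ler1n.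
  have := hadd (z / 2 ^+ n.+1) (z / 2 ^+ n.+1) (lt _) (lt _).
  by rewrite e IH => /(_ (lt _)); lra.
have hc e : 0 < e -> exists2 r, 0 < r & forall t, `|t| < r -> `|h t| < e.
  move=> e0.
  have : h x @[x --> 0] --> h 0.
    by apply: cvgB => //; apply: cvgM; [exact: cvg_cst|exact: cvg_id].
  move=> /cvgrPdist_lt /(_ _ e0) /nbhs_ballP[r /= r0 H]; exists r => // t tr.
  have := H t; rewrite /ball /= sub0r normrN => /(_ tr).
  by rewrite {1}/h g0 mulr0 subr0 sub0r normrN.
have hnneg x : 0 <= x -> x < d -> h x = 0.
  move=> x0 xd; apply/eqP; rewrite -normr_le0; apply/ler_addgt0Pl => e e0.
  rewrite addr0; have [r r0 Hr] := hc e e0.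
  have [n nr] : exists n, z / 2 ^+ n < r.
    have [n _ /(_ n (leqnn n))] := @near_infty_natSinv_expn_lt R (PosNum (divr_gt0 r0 z0)).
    rewrite /= => nr; exists n.
    by move: nr; rewrite ltr_pdivlMr// mul1r mulrC.
  pose s := z / 2 ^+ n; have s0 : 0 < s by rewrite divr_gt0 ?exprn_gt0.
  have step m t : 0 <= t -> t + m%:R * s < d -> h (t + m%:R * s) = h t.
    move=> t0; elim: m => [|m IH] lt; first by rewrite mul0r addr0.
    have e' : t + m.+1%:R * s = (t + m%:R * s) + s by rewrite -natr1; ring.
    have tm0 : 0 <= t + m%:R * s by rewrite addr_ge0// mulr_ge0// ltW.
    rewrite e' in lt *.
    have n1 : `|t + m%:R * s| < d by rewrite ger0_norm//; lra.
    have n2 : `|s| < d by rewrite gtr0_norm//; lra.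
    have n3 : `|t + m%:R * s + s| < d by rewrite ger0_norm//; lra.
    by rewrite hadd// hz addr0 IH//; lra.
  pose m := Num.truncn (x / s).
  have /andP[m1 m2] : m%:R <= x / s < m.+1%:R.
    by apply: truncn_itv; rewrite divr_ge0// ltW.
  have t0 : 0 <= x - m%:R * s by rewrite subr_ge0 -ler_pdivlMr.
  have ts : x - m%:R * s < s.
    by rewrite ltrBlDr -[X in X + _]mul1r -mulrDl addrC natr1 -ltr_pdivrMr.
  have -> : x = (x - m%:R * s) + m%:R * s by rewrite subrK.
  rewrite step ?subrK//; apply/ltW/Hr; rewrite ger0_norm//.
  exact: lt_trans nr.
exists (g z / z) => x xd; apply/eqP; rewrite -subr_eq0; apply/eqP.
rewrite -/(h x); have [x0|x0] := leP 0 x.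
  by apply: hnneg => //; move: xd; rewrite ger0_norm.
have nx : h (- x) = 0.
  by apply: hnneg; [rewrite oppr_ge0 ltW|move: xd; rewrite ltr0_norm].
have := hadd x (- x); rewrite subrr normrN normr0 nx addr0 => /(_ xd xd d0) <-.
by rewrite /h g0 mulr0 subr0.
Qed.

Section OrientationPreservingRelation.
Variable R : realType.
Notation T := (R * R)%type.
Variables (K : set (T * T)) (Q U : set (R * R)) (f : T -> T).
Hypothesis K_area : forall e1 e2 e3, K e1 -> K e2 -> K e3 ->
  0 <= area e1.1 e2.1 e3.1 * area e1.2 e2.2 e3.2.
Hypothesis K_closed : forall e, ~ K e -> \forall e' \near e, ~ K e'.
Hypothesis Q_compact : compact Q.
Hypothesis K_bounded : forall x y, K (x, y) -> Q y.
Hypothesis K_fun : forall x y y', K (x, y) -> K (x, y') -> y = y'.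
Hypothesis U_open : open U.
Hypothesis Kf : forall x, U x -> K (x, f x).

(** A closed graph with values in a compact set: no [y] in [Q] off a neighbourhood of [f x] is
    paired with [x], and compactness makes this hold uniformly near [x]. *)
Lemma orientation_preserving_continuous x : U x -> f @ x --> f x.
Proof.
move=> Ux N /nbhs_interior Nfx.
have cQN : compact (Q `\` N°).
  apply: (subclosed_compact _ Q_compact) => [|y []//].
  apply: closedI; first by apply: compact_closed => //; exact: norm_hausdorff.
  by apply: open_closedC; exact: open_interior.
have H : \forall x' \near x, (Q `\` N°) `<=` (fun y => ~ K (x', y)).
  have near_cover := (compact_near_coveringP (Q `\` N°)).1 cQN.
  apply: (near_cover _ (nbhs x) (fun x' y => ~ K (x', y))) => y [Qy nNy].
  have nK : ~ K (x, y).
    move=> Kxy; apply: nNy; rewrite (K_fun Kxy (Kf Ux)).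
    exact: nbhs_singleton.
  have [[A B] /= [nA nB] sub] := K_closed nK.
  by exists (B, A) => //= -[y' x'] [? ?]; exact: sub.
have Ux' : nbhs x U by exact: open_nbhs_nbhs.
suff : nbhs x (f @^-1` N) by [].
apply: filterS (filterI H Ux') => x' [Hx' Ux'']; apply: contrapT => nN.
apply: (Hx' (f x')); last exact: Kf.
by split; [exact: K_bounded (Kf Ux'')|move=> /interior_subset].
Qed.

Lemma cvg_line_point (p n : T) :
  (fun t : R => (p.1 + t * n.1, p.2 + t * n.2)) @ 0 --> p.
Proof.
rewrite [X in _ --> X](_ : p = (p.1 + 0 * n.1, p.2 + 0 * n.2)); last first.
  by rewrite !mul0r !addr0; case: (p).
apply: (@cvg_pair _ _ _ _ (nbhs (p.1 + 0 * n.1)) (nbhs (p.2 + 0 * n.2)));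
  by apply: cvgD; [exact: cvg_cst|apply: cvgM; [exact: cvg_id|exact: cvg_cst]].
Qed.

(* Moving [x2] off the line to either side forces the area of the images to be
   both nonnegative and nonpositive in the limit. *)
Lemma orientation_preserving_collinear x1 x2 x3 : U x1 -> U x2 -> U x3 ->
  area x1 x2 x3 = 0 -> area (f x1) (f x2) (f x3) = 0.
Proof.
move=> U1 U2 U3 a0; have [e|neq] := eqVneq x1 x3; first by rewrite e area_diag.
apply: contrapT => /eqP fa0.
pose n : T := (x3.2 - x1.2, x1.1 - x3.1).
pose q t : T := (x2.1 + t * n.1, x2.2 + t * n.2).
pose c := (x3.2 - x1.2) ^+ 2 + (x1.1 - x3.1) ^+ 2.
have c0 : 0 < c.
  rewrite lt_neqAle addr_ge0 ?sqr_ge0// andbT eq_sym paddr_eq0 ?sqr_ge0//.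
  rewrite !sqrf_eq0 !subr_eq0; apply: contra neq => /andP[/eqP h2 /eqP h1].
  by rewrite [x1]surjective_pairing [x3]surjective_pairing h1 h2.
have aq t : area x1 (q t) x3 = t * c.
  by rewrite -[RHS]addr0 -a0 /area /q /c /=; ring.
have cq : q @ 0 --> x2 by exact: cvg_line_point.
have cphi : area (f x1) (f x2) (f x3) * area (f x1) (f (q t)) (f x3) @[t --> 0]
    --> area (f x1) (f x2) (f x3) * area (f x1) (f x2) (f x3).
  apply: cvgM; first exact: cvg_cst.
  apply: cvg_area; (try exact: cvg_cst).
  exact: (cvg_comp q f cq (orientation_preserving_continuous U2)).
have pos : 0 < area (f x1) (f x2) (f x3) * area (f x1) (f x2) (f x3).
  by rewrite -expr2 exprn_even_gt0.
have near1 : \forall t \near (0 : R),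
    0 < area (f x1) (f x2) (f x3) * area (f x1) (f (q t)) (f x3).
  exact: cvgr_gt cphi _ pos.
have near2 : \forall t \near (0 : R), U (q t) by apply: cq; exact: open_nbhs_nbhs.
have near12 : nbhs (0 : R) [set t |
    0 < area (f x1) (f x2) (f x3) * area (f x1) (f (q t)) (f x3) /\ U (q t)].
  exact: filterI near1 near2.
have /nbhs_ballP[r /= r0 Hr] := near12.
pose s := area (f x1) (f x2) (f x3).
have [t tr ts] : exists2 t : R, `|t| < r & t * s < 0.
  exists (- (r / 2) * Num.sg s).
    rewrite normrM normr_sg fa0 mulr1 normrN gtr0_norm ?divr_gt0//.
    by rewrite ltr_pdivrMr// ltr_pMr// ltr1n.
  rewrite -mulrA -normrEsg mulNr oppr_lt0.
  by rewrite mulr_gt0 ?divr_gt0// normr_gt0.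
have [] := Hr t; first by rewrite /ball /= sub0r normrN.
rewrite -/s => h1 h2.
have := K_area (Kf U1) (Kf h2) (Kf U3); rewrite /= aq => h3.
move: h1 h3; set u := area _ (f (q t)) _ => h1 h3.
have : (t * c * u) * (s * u) = (t * s) * (c * u ^+ 2) by ring.
have u0 : u != 0 by apply/eqP => e; move: h1; rewrite e mulr0 ltxx.
have : 0 <= t * c * u * (s * u) by rewrite mulr_ge0// ltW.
move=> + e; rewrite e leNgt; apply/negP; rewrite negbK.
by rewrite nmulr_rlt0// mulr_gt0// exprn_even_gt0.
Qed.

End OrientationPreservingRelation.

Section LocalProjective.
Variable R : realType.
Notation T := (R * R)%type.
Notation hom := (@homogeneous R).

Lemma pair_eq_components (p q : T) : p.1 = q.1 -> p.2 = q.2 -> p = q.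
Proof. by move=> h1 h2; rewrite [p]surjective_pairing h1 h2 -surjective_pairing. Qed.

Lemma area_two_lines (a b d p : T) : area a b d != 0 ->
  area p b d = 0 -> area p a d = 0 -> p = d.
Proof.
move=> n e1 e2.
have c1 : area a b d * (p.1 - d.1) = 0.
  have -> : area a b d * (p.1 - d.1) =
      area p b d * (a.1 - d.1) - area p a d * (b.1 - d.1) by rewrite /area; ring.
  by rewrite e1 e2; ring.
have c2 : area a b d * (p.2 - d.2) = 0.
  have -> : area a b d * (p.2 - d.2) =
      area p b d * (a.2 - d.2) - area p a d * (b.2 - d.2) by rewrite /area; ring.
  by rewrite e1 e2; ring.
move/eqP: c1; move/eqP: c2; rewrite !mulf_eq0 (negbTE n)/= !subr_eq0.
by move=> /eqP h2 /eqP h1; exact: pair_eq_components.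
Qed.

(** Cramer's rule in the basis [hom a], [hom b], [hom d], scaled so that [hom d] has coefficient
    1. *)
Lemma homogeneous_coords (a b d p : T) : area a b d != 0 -> area a b p != 0 ->
  (area a b d / area a b p) *: hom p =
  pencil_coord a b d b p *: hom a - pencil_coord a b d a p *: hom b + hom d.
Proof.
move=> nd np; rewrite /pencil_coord; apply: col3P;
  rewrite !mxE /= ?homogeneousE; apply: (mulfI np);
  rewrite /area in np *; by field.
Qed.

Variables (U : set (R * R)) (f : T -> T).
Hypothesis U_open : open U.
Hypothesis f_continuous : forall x, U x -> f @ x --> f x.
Hypothesis f_collinear : forall x y z, U x -> U y -> U z ->
  area x y z = 0 -> area (f x) (f y) (f z) = 0.
Hypothesis f_inj : forall x y, U x -> U y -> f x = f y -> x = y.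
Hypothesis f_nondegenerate : forall L : set (R * R), is_line L -> exists2 x, U x & ~ L (f x).

(* Three collinear points [A], [B], [C] are sent to infinity: the three pencils
   of lines through them are then three families of parallel lines, which [f]
   permutes, and Cauchy's functional equation makes [f] affine. *)
Lemma locally_projective : U !=set0 -> exists (M : 'M[R]_3) (W : set (R * R)) (c : T -> R),
  [/\ M \in unitmx, open W, W !=set0, W `<=` U &
    forall x, W x -> 0 < c x /\ hom (f x) = c x *: (M *m hom x)].
Proof.
move=> [z0 Uo].
have /nbhs_ballP[r /= r0 rU] : nbhs z0 U by exact: open_nbhs_nbhs.
have inU x : `|x| < r -> U (z0.1 + x, z0.2).
  move=> xr; apply: rU; split; rewrite /ball /=.
    by rewrite opprD addNKr normrN.
  by rewrite subrr normr0.
have r2 : `|r / 2| < r.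
  by rewrite gtr0_norm ?divr_gt0// ltr_pdivrMr// ltr_pMr// ltr1n.
(* The third collinear point is the midpoint [z0] of [A] and [B], so that its pencil has coordinate
   half of [X + Y]. *)
pose A : T := (z0.1 + r / 2, z0.2); pose B : T := (z0.1 + - (r / 2), z0.2).
have UA : U A by exact: inU.
have UB : U B by apply: inU; rewrite normrN.
have AB : A != B by rewrite xpair_eqE eqxx andbT; apply/eqP; lra.
have Ao : A != z0 by apply/eqP => /(congr1 fst) /=; lra.
have Bo : B != z0 by apply/eqP => /(congr1 fst) /=; lra.
have ABo : area A B z0 = 0 by rewrite /area /=; ring.
have oE1 : z0.1 = 2^-1 * A.1 + 2^-1 * B.1 by rewrite /=; field.
have oE2 : z0.2 = 2^-1 * A.2 + 2^-1 * B.2 by rewrite /=; field.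
pose a := f A; pose b := f B; pose co := f z0.
have ab : a != b by apply: contra AB => /eqP /f_inj ->.
have aco : a != co by apply: contra Ao => /eqP /f_inj ->.
have bco : b != co by apply: contra Bo => /eqP /f_inj ->.
have abco : area a b co = 0 by exact: f_collinear.
have [l [coE1 coE2]] := collinear_combination abco ab.
have l0 : l != 0.
  apply: contra bco => /eqP e; move: coE1 coE2; rewrite e !mul0r !add0r subr0 !mul1r.
  by move=> h1 h2; apply/eqP/pair_eq_components.
have l1 : 1 - l != 0.
  apply: contra aco; rewrite subr_eq0 => /eqP e; move: coE1 coE2.
  rewrite -e subrr !mul0r !addr0 !mul1r.
  by move=> h1 h2; apply/eqP/pair_eq_components.
(* [D] is the origin of the source chart and [d] that of the target chart: [d] is off the line [ab],
   which forces [D] off the line [AB]. *)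
have [D UD nD] := f_nondegenerate (is_line_area ab).
pose d := f D.
have nd : area a b d != 0 by apply/eqP; rewrite -area_rot; exact: nD.
have nABD : area A B D != 0.
  by apply: contra nd => /eqP h; apply/eqP; exact: f_collinear.
pose X := pencil_coord A B D B; pose Y := pencil_coord A B D A.
pose X' p := pencil_coord a b d b (f p); pose Y' p := pencil_coord a b d a (f p).
pose G p := [/\ U p, area A B p != 0 & area a b (f p) != 0].
have XX' p q : G p -> G q -> X p = X q -> X' p = X' q.
  move=> [Up Ap ap] [Uq Aq aq] /pencil_coord_collinear.
  move=> /(_ (area_diagr _ _) AB nABD Ap Aq) h.
  by apply/pencil_coord_collinear => //; [exact: area_diagr|exact: f_collinear].
have YY' p q : G p -> G q -> Y p = Y q -> Y' p = Y' q.
  move=> [Up Ap ap] [Uq Aq aq] /pencil_coord_collinear.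
  move=> /(_ (area_diag _ _) AB nABD Ap Aq) h.
  by apply/pencil_coord_collinear => //; [exact: area_diag|exact: f_collinear].
have ZZ' p q : G p -> G q -> X p + Y p = X q + Y q ->
    (1 - l) * X' p + l * Y' p = (1 - l) * X' q + l * Y' q.
  have Zo s : 2 * pencil_coord A B D z0 s = X s + Y s.
    rewrite /X /Y /pencil_coord -mulrDl mulrA; congr (_ / _).
    by rewrite /area oE1 oE2; field.
  have Zco s : pencil_coord a b d co s = (1 - l) * pencil_coord a b d b s + l * pencil_coord a b d a s.
    rewrite /pencil_coord !mulrA -mulrDl; congr (_ / _).
    by rewrite /area coE1 coE2; ring.
  move=> [Up Ap ap] [Uq Aq aq]; rewrite -!Zo => /(mulfI _) h.
  have {}h : pencil_coord A B D z0 p = pencil_coord A B D z0 q by apply: h; rewrite pnatr_eq0.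
  move: h => /pencil_coord_collinear => /(_ ABo AB nABD Ap Aq) h.
  rewrite /X' /Y' -!Zco; apply/pencil_coord_collinear => //.
  exact: f_collinear.
(* [pt] inverts the chart: [pt (x, y)] has pencil coordinates [x] and [y]. The formula is read off
   [homogeneous_coords], the third homogeneous coordinate being [1 + x - y]. *)
pose pt (w : T) : T := ((w.1 * A.1 - w.2 * B.1 + D.1) / (1 + w.1 - w.2),
                        (w.1 * A.2 - w.2 * B.2 + D.2) / (1 + w.1 - w.2)).
have pt0 : pt (0, 0) = D.
  by rewrite /pt /= !mul0r !subr0 !add0r !addr0 !divr1 -surjective_pairing.
have cf1 : (fun w : T => w.1) @ ((0, 0) : T) --> (0 : R) by exact: (@cvg_fst_comp _ _ _ _ _ ((0, 0) : T)).
have cf2 : (fun w : T => w.2) @ ((0, 0) : T) --> (0 : R) by exact: (@cvg_snd_comp _ _ _ _ _ ((0, 0) : T)).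
have cden : (fun w : T => 1 + w.1 - w.2) @ ((0, 0) : T) --> (1 : R).
  rewrite -[X in _ --> X](_ : 1 + 0 - 0 = 1); last by rewrite addr0 subr0.
  by apply: cvgB => //; apply: cvgD => //; exact: cvg_cst.
have cpt : pt @ ((0, 0) : T) --> D.
  have cc (u v w : R) : (fun z : T => (z.1 * u - z.2 * v + w) / (1 + z.1 - z.2)) @ ((0, 0) : T) --> w.
    rewrite -[X in _ --> X](_ : (0 * u - 0 * v + w) / 1 = w); last first.
      by rewrite !mul0r subrr add0r divr1.
    apply: cvgM; last by apply: cvgV => //; exact: oner_neq0.
    by apply: cvgD; [apply: cvgB; apply: cvgM => //; exact: cvg_cst|exact: cvg_cst].
  rewrite [D]surjective_pairing.
  exact: (@cvg_pair _ _ _ _ (nbhs D.1) (nbhs D.2) _ _ _ _ _ (cc _ _ _) (cc _ _ _)).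
have cAB : (fun p => area A B p) @ D --> area A B D.
  by apply: cvg_area; (try exact: cvg_cst); exact: cvg_id.
have cab : (fun p => area a b (f p)) @ D --> area a b d.
  by apply: cvg_area; (try exact: cvg_cst); exact: f_continuous.
have near_neq0 (g : T -> R) (v : R) : g @ D --> v -> v != 0 -> \forall p \near D, 0 < g p * v.
  move=> cg v0; have cv : g p * v @[p --> D] --> v * v by apply: cvgM => //; exact: cvg_cst.
  by apply: (cvgr_gt _ cv); rewrite -expr2 exprn_even_gt0.
have nearG : \forall p \near D, [/\ U p, 0 < area A B p * area A B D &
    0 < area a b (f p) * area a b d].
  have n1 := near_neq0 _ _ cAB nABD; have n2 := near_neq0 _ _ cab nd.
  have n3 : nbhs D U by exact: open_nbhs_nbhs.
  by apply: filterS3 n1 n2 n3.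
have GG p : [/\ U p, 0 < area A B p * area A B D & 0 < area a b (f p) * area a b d] -> G p.
  move=> [Up h1 h2]; split => //.
    by apply: contraTneq h1 => ->; rewrite mul0r ltxx.
  by apply: contraTneq h2 => ->; rewrite mul0r ltxx.
have [e e0 He] : exists2 e : R, 0 < e & forall x y, `|x| < e -> `|y| < e ->
    G (pt (x, y)) /\ 1 + x - y != 0.
  have n1 : \forall w \near ((0, 0) : T), G (pt w).
    by apply: filterS (cpt _ nearG) => w; exact: GG.
  have n2 : \forall w \near ((0, 0) : T), 0 < 1 + w.1 - w.2.
    by apply: (cvgr_gt _ cden); exact: ltr01.
  have n12 : nbhs ((0, 0) : T) [set w | G (pt w) /\ 0 < 1 + w.1 - w.2] by exact: filterI n1 n2.
  have /nbhs_ballP[e /= e0 He] := n12.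
  exists e => // x y xe ye; have [] := He (x, y).
    by split; rewrite /ball /= sub0r normrN.
  by move=> ? /= h; split=> //; rewrite gt_eqF.
have GptX x y : 1 + x - y != 0 -> X (pt (x, y)) = x.
  move=> n; rewrite /X /pencil_coord.
  have -> : area (pt (x, y)) B D = x / (1 + x - y) * area A B D by rewrite /area /pt /=; field.
  have -> : area A B (pt (x, y)) = area A B D / (1 + x - y) by rewrite /area /pt /=; field.
  by field; rewrite n nABD.
have GptY x y : 1 + x - y != 0 -> Y (pt (x, y)) = y.
  move=> n; rewrite /Y /pencil_coord.
  have -> : area (pt (x, y)) A D = y / (1 + x - y) * area A B D by rewrite /area /pt /=; field.
  have -> : area A B (pt (x, y)) = area A B D / (1 + x - y) by rewrite /area /pt /=; field.
  by field; rewrite n nABD.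
have e00 : `|0 : R| < e by rewrite normr0.
have X'D : X' D = 0 by rewrite /X' /pencil_coord -/d area_diag mul0r.
have Y'D : Y' D = 0 by rewrite /Y' /pencil_coord -/d area_diag mul0r.
have X'pt x y : `|x| < e -> `|y| < e -> X' (pt (x, y)) = X' (pt (x, 0)).
  move=> xe ye; have [G1 n1] := He _ _ xe ye; have [G2 n2] := He _ _ xe e00.
  by apply: XX'; rewrite ?GptX.
have Y'pt x y : `|x| < e -> `|y| < e -> Y' (pt (x, y)) = Y' (pt (0, y)).
  move=> xe ye; have [G1 n1] := He _ _ xe ye; have [G2 n2] := He _ _ e00 ye.
  by apply: YY'; rewrite ?GptY.
(* The factors [1 - l] and [l] record the position of [co] on [ab]. With them, comparing [pt (x, y)]
   with [pt (x + y, 0)], on the same line of the third pencil, becomes additivity of [g]. *)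
pose g t := (1 - l) * X' (pt (t, 0)).
have g0 : g 0 = 0 by rewrite /g pt0 X'D mulr0.
have sum_rule x y : `|x| < e -> `|y| < e -> `|x + y| < e ->
    g x + l * Y' (pt (0, y)) = g (x + y).
  move=> xe ye xye; have [G1 n1] := He _ _ xe ye; have [G2 n2] := He _ _ xye e00.
  have := ZZ' _ _ G1 G2; rewrite !GptX// !GptY// addr0 => /(_ erefl).
  by rewrite X'pt// Y'pt// (Y'pt (x + y))// pt0 Y'D mulr0 addr0.
have gY y : `|y| < e -> l * Y' (pt (0, y)) = g y.
  by move=> ye; have := sum_rule 0 y e00 ye; rewrite add0r g0 add0r; apply.
have cg : g x @[x --> 0] --> g 0.
  rewrite /g pt0; apply: cvgM; first exact: cvg_cst.
  have c0 : (fun t : R => ((t, 0) : T)) @ 0 --> ((0, 0) : T).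
    apply: (@cvg_pair _ _ _ _ (nbhs (0 : R)) (nbhs (0 : R))); [exact: cvg_id|exact: cvg_cst].
  have c1 : (fun t : R => f (pt (t, 0))) @ 0 --> d.
    have c2 := cvg_comp _ _ c0 cpt.
    exact: (cvg_comp _ _ c2 (f_continuous UD)).
  apply: cvgM; first by apply: cvg_area => //; exact: cvg_cst.
  by apply: cvgV => //; apply: cvg_area => //; exact: cvg_cst.
have [k gk] : exists k, forall x, `|x| < e -> g x = k * x.
  apply: locally_additive_linear => // x y xe ye xye.
  by rewrite -(gY y)// sum_rule.
have k0 : k != 0.
  apply/eqP => kz; have e2 : `|e / 2| < e.
    by rewrite gtr0_norm ?divr_gt0// ltr_pdivrMr// ltr_pMr// ltr1n.
  have [[Up Ap ap] n1] := He _ _ e2 e00; set p := pt _ in Up Ap ap.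
  have x0 : X' p = 0.
    have := gk _ e2; rewrite kz mul0r /g => /eqP.
    by rewrite mulf_eq0 (negbTE l1)/= => /eqP.
  have y0 : Y' p = 0 by rewrite /p Y'pt// pt0.
  have : f p = d.
    apply: (area_two_lines nd); apply/eqP.
      by move/eqP: x0; rewrite mulf_eq0 invr_eq0 (negbTE ap) orbF.
    by move/eqP: y0; rewrite mulf_eq0 invr_eq0 (negbTE ap) orbF.
  move=> /f_inj => /(_ Up UD) pD; have := GptX _ _ n1; rewrite -/p pD.
  rewrite /X /pencil_coord area_diag mul0r => /esym/eqP.
  by rewrite mulf_eq0 invr_eq0 pnatr_eq0 orbF gt_eqF.
have X'E p : G p -> `|X p| < e -> X' p = k / (1 - l) * X p.
  move=> Gp Xe; have [G1 n1] := He _ _ Xe e00.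
  rewrite (XX' p (pt (X p, 0)))// ?GptX//; apply: (mulfI l1).
  by rewrite -/(g _) gk//; field.
have Y'E p : G p -> `|Y p| < e -> Y' p = k / l * Y p.
  move=> Gp Ye; have [G1 n1] := He _ _ e00 Ye.
  rewrite (YY' p (pt (0, Y p)))// ?GptY//; apply: (mulfI l0).
  by rewrite gY// gk//; field.
(* [M] sends the basis [hom A], [hom B], [hom D] to multiples of the image basis; [k / (1 - l)] and
   [k / l] are the slopes of [X'] in [X] and of [Y'] in [Y]. *)
pose N1 := col3_mx (hom A) (hom B) (hom D).
pose N2 := col3_mx ((k / (1 - l)) *: hom a) ((k / l) *: hom b) (hom d).
have dN1 : \det N1 = area A B D by rewrite det_col3_homogeneous area_vec_homogeneous.
have dN2 : \det N2 = k / (1 - l) * (k / l) * area a b d.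
  rewrite -area_vec_homogeneous -det_col3_homogeneous !det_col3 !mxE /=; ring.
have uN1 : N1 \in unitmx by rewrite unitmxE dN1 unitfE.
pose M := N2 *m invmx N1.
have MN1 : M *m N1 = N2 by rewrite mulmxKV.
move: (MN1); rewrite mulmx_col3 => MN.
have col_inj (u v w u' v' w' : 'cV[R]_3) : col3_mx u v w = col3_mx u' v' w' ->
    [/\ u = u', v = v' & w = w'].
  move=> /matrixP h; split; apply/matrixP => i j; rewrite (ord1 j).
  - by have := h i 0; rewrite !mxE.
  - by have := h i 1; rewrite !mxE.
  - by have := h i 2%:R; rewrite !mxE.
have [MA MB MD] := col_inj _ _ _ _ _ _ MN.
pose s p := area A B D / area A B p; pose s' p := area a b d / area a b (f p).
(* Both areas keep the sign they have at [D], which makes the scalar [s p / s' p] positive; this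
   positivity lets orientations be compared through [M]. *)
pose good := [set p | [/\ U p, 0 < area A B p * area A B D &
  0 < area a b (f p) * area a b d] /\ (`|X p| < e /\ `|Y p| < e)].
have goodM p : good p -> 0 < s p / s' p /\ hom (f p) = (s p / s' p) *: (M *m hom p).
  move=> [/[dup] [[Up h1 h2]] /GG Gp [Xe Ye]].
  have [_ Ap ap] := Gp.
  have sn : s p != 0 by rewrite mulf_neq0// invr_eq0.
  have s'n : s' p != 0 by rewrite mulf_neq0// invr_eq0.
  split.
    have -> : s p / s' p = (area A B p * area A B D) * (area a b (f p) * area a b d) *
        (area A B p * area a b d) ^- 2 by rewrite /s /s'; field; rewrite nd Ap ap.
    apply: mulr_gt0; first exact: mulr_gt0.
    by rewrite invr_gt0 exprn_even_gt0//= mulf_neq0.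
  apply: (scalerI s'n); rewrite scalerA mulrC divfK//.
  rewrite homogeneous_coords// -/(X' p) -/(Y' p) X'E// Y'E//.
  rewrite scalemxAr homogeneous_coords// mulmxDr mulmxBr -!scalemxAr MA MB MD.
  by rewrite !scalerA -/(X p) -/(Y p) ![k / _ * _]mulrC.
have near_good : \forall p \near D, good p.
  have coordD z : area D z D = 0 -> \forall p \near D, `|pencil_coord A B D z p| < e.
    move=> z0'; have c : pencil_coord A B D z p @[p --> D] --> (0 : R).
      rewrite -[X in _ --> X](_ : area D z D / area A B D = 0); last by rewrite z0' mul0r.
      apply: cvgM; first by apply: cvg_area; (try exact: cvg_cst); exact: cvg_id.
      exact: cvgV.
    move/cvgrPdist_lt : c => /(_ e e0); apply: filterS => p.
    by rewrite sub0r normrN.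
  apply: filterS3 nearG (coordD B (area_diag _ _)) (coordD A (area_diag _ _)) => p h1 h2 h3.
  by split.
exists M, good°, (fun p => s p / s' p); split.
- rewrite unitmxE -(mulr1 (\det M)) unitfE.
  have : \det M * \det N1 != 0.
    by rewrite -det_mulmx MN1 dN2 !mulf_neq0// invr_eq0.
  by rewrite mulr1 mulf_eq0 negb_or => /andP[].
- exact: open_interior.
- by exists D; apply: nbhs_singleton; exact: nbhs_interior.
- by move=> p /interior_subset [[]].
by move=> p /interior_subset; exact: goodM.
Qed.

End LocalProjective.

(** * Projective maps *)

Section ProjectiveExtension.
Variable R : realType.
Notation T := (R * R)%type.
Notation hom := (@homogeneous R).

Lemma homogeneous_neq0 (p : T) : hom p != 0.
Proof.
apply/eqP => /matrixP /(_ 2%:R 0); rewrite homogeneousE mxE.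
by apply/eqP; exact: oner_neq0.
Qed.

Lemma det_col3Z (a b c : R) (u v w : 'cV[R]_3) :
  \det (col3_mx (a *: u) (b *: v) (c *: w)) = a * b * c * \det (col3_mx u v w).
Proof. by rewrite !det_col3 !mxE; ring. Qed.

(** Pulled back by [M], the point [y] becomes a vector [v], possibly at infinity, that is weakly on
    the same side as [x] of every line through two points of [W]; separation makes [v] proportional
    to [hom x]. *)
Lemma projective_of_local (K : set (T * T)) (W : set (R * R)) (f : T -> T)
    (c : T -> R) (M : 'M[R]_3) :
  (forall e1 e2 e3, K e1 -> K e2 -> K e3 ->
    0 <= area e1.1 e2.1 e3.1 * area e1.2 e2.2 e3.2) ->
  open W -> W !=set0 -> M \in unitmx ->
  (forall x, W x -> [/\ K (x, f x), 0 < c x & hom (f x) = c x *: (M *m hom x)]) ->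
  forall x y, K (x, y) -> exists2 k : R, k != 0 & M *m hom x = k *: hom y.
Proof.
move=> K_area oW W0 uM HW x y Kxy.
have dM : \det M != 0 by rewrite -unitfE -unitmxE.
(* The factor [\det M] cancels the determinant of [M] from the sign condition, even when it is
   negative. *)
pose v := \det M *: (invmx M *m hom y).
have yE : hom y = (\det M)^-1 *: (M *m v).
  by rewrite /v -scalemxAr mulKVmx// scalerA mulVf// scale1r.
have H i j : hom x i 0 * v j 0 = hom x j 0 * v i 0.
  apply: (area_vec_separation oW W0) => a b Wa Wb.
  have [Ka ca fa] := HW _ Wa; have [Kb cb fb] := HW _ Wb.
  have := K_area _ _ _ Ka Kb Kxy; rewrite /= -!area_vec_homogeneous.
  rewrite -(det_col3_homogeneous (f a)) fa fb yE.
  have -> : \det (col3_mx (c a *: (M *m hom a)) (c b *: (M *m hom b))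
      ((\det M)^-1 *: (M *m v))) = c a * c b * area_vec a b v.
    by rewrite det_col3Z -mulmx_col3 det_mulmx det_col3_homogeneous; field.
  have -> : area_vec a b (hom x) * (c a * c b * area_vec a b v) =
    (c a * c b) * (area_vec a b (hom x) * area_vec a b v) by ring.
  by rewrite pmulr_rge0// mulr_gt0.
have vE : v = v 2%:R 0 *: hom x.
  apply/matrixP => i j; rewrite (ord1 j) [RHS]mxE.
  by have := H 2%:R i; rewrite homogeneousE mul1r => ->; exact: mulrC.
have v0 : v 2%:R 0 != 0.
  apply/eqP => v0; have := homogeneous_neq0 y.
  by rewrite yE vE v0 scale0r mulmx0 scaler0 eqxx.
exists (\det M / v 2%:R 0); first by rewrite mulf_neq0// invr_eq0.
apply: (scalerI v0); rewrite scalemxAr -vE scalerA mulrC divfK//.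
by rewrite yE scalerA mulfV// scale1r.
Qed.

End ProjectiveExtension.

Section ProjectiveMap.
Variable R : realType.
Notation T := (R * R)%type.
Notation hom := (@homogeneous R).
Variable N : 'M[R]_3.

Definition row_form (i : 'I_3) (q : T) : R := N i 0 * q.1 + N i 1 * q.2 + N i 2%:R.

Lemma row_formE i q : (N *m hom q) i 0 = row_form i q.
Proof.
rewrite mxE !big_ord_recl big_ord0 /row_form.
have -> : lift ord0 (ord0 : 'I_2) = 1 :> 'I_3 by exact: val_inj.
have -> : lift ord0 (lift ord0 (ord0 : 'I_1)) = 2%:R :> 'I_3 by exact: val_inj.
by rewrite !homogeneousE; ring.
Qed.

(* Points sent to the line at infinity are mapped to [(0, 0)], because
   [x / 0 = 0]. *)
Definition projective_map (q : T) : T :=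
  (row_form 0 q / row_form 2%:R q, row_form 1 q / row_form 2%:R q).

Lemma continuous_row_form i : continuous (row_form i).
Proof.
move=> q; apply: cvgD; last exact: cvg_cst.
by apply: cvgD; apply: cvgM; (try exact: cvg_cst); [exact: cvg_fst|exact: cvg_snd].
Qed.

Lemma open_projective_preimage (O : set (R * R)) : open O ->
  open [set q | row_form 2%:R q != 0 /\ O (projective_map q)].
Proof.
move=> oO; rewrite openE => q [s0 Oq]; rewrite /interior.
have c1 : projective_map @ q --> projective_map q.
  by apply: (@cvg_pair _ _ _ _ (nbhs _) (nbhs _)); apply: cvgM;
    (try exact: continuous_row_form); apply: cvgV => //; exact: continuous_row_form.
have n1 : nbhs q [set q' | O (projective_map q')].
  by apply: c1; exact: open_nbhs_nbhs.
have n2 : nbhs q [set q' | row_form 2%:R q' != 0].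
  have c2 : row_form 2%:R @ q --> row_form 2%:R q by exact: continuous_row_form.
  by apply: (cvgr_neq0 _ c2).
by apply: filterS2 n1 n2 => q' h1 h2.
Qed.

Lemma measurable_projective_map : measurable_fun [set: T] projective_map.
Proof.
apply: (measurability (@open T)); first exact: measurable_plane_borel.
move=> _ [V oV <-]; rewrite setTI.
(* Where the denominator vanishes the map is constantly [(0, 0)], so [V] captures either all of that
   part or nothing. *)
have -> : projective_map @^-1` V =
    [set q | row_form 2%:R q != 0 /\ V (projective_map q)] `|`
    ([set q | row_form 2%:R q = 0] `&` [set _ | V (0, 0)]).
  apply/seteqP; split=> q /=.
    have [e|] := eqVneq (row_form 2%:R q) 0; last by left.
    by rewrite /projective_map e invr0 !mulr0 => h; right.
  by move=> [[]//|[e]]; rewrite /projective_map e invr0 !mulr0.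
apply: measurableU.
  by apply: open_measurable_plane; exact: open_projective_preimage.
apply: measurableI.
  apply: closed_measurable_plane.
  apply: (@closed_comp _ _ (row_form 2%:R) [set 0]); last exact: closed_eq.
  by move=> q _; exact: continuous_row_form.
have [h|h] := pselect (V (0, 0)).
  by rewrite (_ : [set _ | _] = setT)//; apply/seteqP; split.
by rewrite (_ : [set _ | _] = set0)//; apply/seteqP; split.
Qed.

Hypothesis N_unit : N \in unitmx.

Lemma projective_imageE (A : set (R * R)) : projective_image (invmx N) A =
  [set q | row_form 2%:R q != 0 /\ A (projective_map q)].
Proof.
apply/seteqP; split=> q /=.
  move=> [p Ap [c c0 e]].
  have {}e : hom p = c *: (N *m hom q).
    by rewrite scalemxAr -e mulKVmx.
  have e2 : 1 = c * row_form 2%:R q by rewrite -row_formE -(homogeneousE p).2 e mxE.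
  have s0 : row_form 2%:R q != 0 by apply: contraTneq (oner_neq0 R) => h; rewrite e2 h mulr0 eqxx.
  have cE : c = (row_form 2%:R q)^-1 by apply: (mulIf s0); rewrite -e2 mulVf.
  split=> //; rewrite (_ : projective_map q = p)//; apply: pair_eq_components => /=.
    by rewrite -(homogeneousE p).1.1 e mxE row_formE cE mulrC.
  by rewrite -(homogeneousE p).1.2 e mxE row_formE cE mulrC.
move=> [s0 Aq]; exists (projective_map q) => //.
exists (row_form 2%:R q)^-1; first by rewrite invr_eq0.
have -> : hom (projective_map q) = (row_form 2%:R q)^-1 *: (N *m hom q).
  by apply: col3P; rewrite [RHS]mxE row_formE homogeneousE /= ?mulVf// mulrC.
by rewrite -scalemxAr mulKmx.
Qed.

Lemma measurable_projective_image (A : set (R * R)) : measurable A ->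
  measurable (projective_image (invmx N) A).
Proof.
move=> mA; rewrite projective_imageE.
rewrite (_ : [set q | _] = ~` [set q | row_form 2%:R q = 0] `&` projective_map @^-1` A).
  apply: measurableI.
    apply: measurableC; apply: closed_measurable_plane.
    apply: (@closed_comp _ _ (row_form 2%:R) [set 0]); last exact: closed_eq.
    by move=> q _; exact: continuous_row_form.
  by have := measurable_projective_map measurableT mA; rewrite setTI.
by apply/seteqP; split=> q /= [/eqP].
Qed.

Lemma measure_projective_image (mu : probability (R * R)%type R) (A : set (R * R)) :
  (forall L : set (R * R), is_line L -> mu L = 0%E) -> measurable A ->
  mu (projective_image (invmx N) A) = mu (projective_map @^-1` A).
Proof.
move=> line0 mA; have mG : measurable (projective_map @^-1` A).
  by have := measurable_projective_map measurableT mA; rewrite setTI.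
have mI := measurable_projective_image mA.
pose Z := [set q | row_form 2%:R q = 0].
have [mZ Z0] : measurable Z /\ mu Z = 0%E.
  (* [Z] is the set sent to infinity. It is a null line unless both linear coefficients vanish; the
     form is then a constant, non-zero since an invertible matrix has no zero row, and [Z] is
     empty. *)
  have [e|ne] := eqVneq (N 2%:R 0, N 2%:R 1) (0, 0); last first.
    have lZ : is_line Z.
      exists (N 2%:R 0), (N 2%:R 1), (- N 2%:R 2%:R); split=> //.
      by apply/seteqP; split=> q; rewrite /Z /= /row_form => h; lra.
    by split; [exact: measurable_line|exact: line0].
  have Z0 : Z = set0.
    apply/seteqP; split=> // q; rewrite /Z /= /row_form.
    case: e => e0 e1; rewrite e0 e1 !mul0r !add0r => e3.
    have /matrixP/(_ 2%:R 0) := mulKVmx N_unit (delta_mx 2%:R 0 : 'cV[R]_3).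
    rewrite [RHS]mxE !eqxx mxE big1 => [/eqP|k _]; first by rewrite eq_sym oner_eq0.
    have Nk : N 2%:R k = 0 by case: (ord3P k) => ->; rewrite ?e0 ?e1 ?e3.
    by rewrite Nk mul0r.
  by rewrite Z0; split; [exact: measurable0|exact: measure0].
apply/eqP; rewrite eq_le; apply/andP; split.
  apply: le_measure; [exact/mem_set|exact/mem_set|].
  by rewrite projective_imageE => q [].
rewrite -[leRHS]adde0 -Z0; apply: le_trans (measureU2 _ mI mZ).
apply: le_measure; [exact/mem_set|by apply/mem_set; exact: measurableU|].
move=> q Aq; rewrite projective_imageE.
by have [|] := eqVneq (row_form 2%:R q) 0; [right|left].
Qed.

End ProjectiveMap.

(** * Transport of one measure to the other *)

Section MeasureTransfer.
Variable R : realType.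
Notation T := (R * R)%type.
Notation hom := (@homogeneous R).
Variables mu1 mu2 : probability (R * R)%type R.
Variable P : set (T * T) -> R.
Hypothesis cP : order_coupling mu1 mu2 P.

Lemma coupling_fst_closed C : closed C -> ((P (fst @^-1` C))%:E <= mu1 C)%E.
Proof.
move=> cC; have mC := closed_measurable_plane cC.
have := coupling_fst cP (closed_openC cC); rewrite probability_setC//.
have fC := fin_num_measure mu1 _ mC.
rewrite -(fineK fC) -EFinB !lee_fin preimage_setC.
by have := couplingC cP (fst @^-1` C); lra.
Qed.

(** Complements reverse the inequality on closed sets, and exhaustion through compact sets carries
    the reversed one to open sets; these generate the Borel sets and are stable under
    intersection. *)
Lemma probability_eq_of_open_le (nu mu : probability (R * R)%type R) :
  (forall O, open O -> (nu O <= mu O)%E) ->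
  forall A, measurable A -> nu A = mu A.
Proof.
move=> le_open.
have ge_closed C : closed C -> (mu C <= nu C)%E.
  move=> cC; have mC := closed_measurable_plane cC.
  have := le_open _ (closed_openC cC); rewrite !probability_setC//.
  have f1 := fin_num_measure nu _ mC; have f2 := fin_num_measure mu _ mC.
  by rewrite -(fineK f1) -(fineK f2) -!EFinB !lee_fin lerD2l lerN2.
have ge_open O : open O -> (mu O <= nu O)%E.
  move=> oO; apply: measure_open_le => // s C cC sC CO.
  have clC : closed C by apply: compact_closed => //; exact: norm_hausdorff.
  have mC := closed_measurable_plane clC.
  apply: (@le_trans _ _ (mu C)).
    apply: le_measure => //; [|exact/mem_set].
    by apply/mem_set; apply: open_measurable_plane; exact: open_rboxes.
  apply: (le_trans (ge_closed _ clC)); apply: le_measure => //; [exact/mem_set|].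
  by apply/mem_set; exact: open_measurable_plane.
move=> A mA.
apply: (measure_unique (@open T) (fun _ => setT)) => //.
- exact: measurable_plane_borel.
- by move=> B C; exact: openI.
- by move=> _; exact: openT.
- by apply/seteqP; split=> // x _; exists 0%N.
- by move=> O oO; apply/eqP; rewrite eq_le le_open// ge_open.
- by move=> _; rewrite -ge0_fin_numE// fin_num_measure.
Qed.

(** Coupling mass over a compact part [D] of the image of an open [V] comes from [V]: the other
    pairs over [D] with first coordinate in [Q1] form a compact set disjoint from [K]. *)
Lemma coupling_projective_image (M : 'M[R]_3) (Q1 : set (R * R)) :
  (forall L : set (R * R), is_line L -> mu2 L = 0%E) ->
  compact Q1 -> P (~` (fst @^-1` Q1)) = 0 -> M \in unitmx ->
  (forall x y, coupling_support P (x, y) ->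
     exists2 c : R, c != 0 & M *m hom x = c *: hom y) ->
  forall A, measurable A -> mu2 (projective_image M A) = mu1 A.
Proof.
move=> line2 cQ1 Q10 uM KM.
have uN : invmx M \in unitmx by rewrite unitmx_inv.
have imageE := projective_imageE uN; have mG := measurable_projective_map (invmx M).
pose G : {mfun T >-> T} := mfun_Sub (mem_set mG).
pose nu : probability T R := distribution mu2 G.
have nuE A : measurable A -> mu2 (projective_image M A) = nu A.
  by move=> mA; have := measure_projective_image uN line2 mA; rewrite invmxK.
rewrite invmxK in imageE.
move=> A mA; rewrite nuE//; apply: probability_eq_of_open_le => // O oO.
(* The coupling mass over a first-coordinate set is bounded by [mu1] when the set is closed, so [V]
   is enlarged to a closed [C]. It is applied to a finite union of boxes trapped with [C] inside
   [O]. *)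
have le_closed V C : open V -> closed C -> V `<=` C -> (mu2 (projective_image M V) <= mu1 C)%E.
  move=> oV clC VC; apply: measure_open_le.
    by rewrite imageE; exact: open_projective_preimage.
  move=> s D cD sD; rewrite imageE => DV.
  apply: (le_trans _ (coupling_fst_closed clC)).
  apply: (le_trans (coupling_snd cP (@open_rboxes R s))); rewrite lee_fin.
  have null : P ((Q1 `\` V) `*` D) = 0.
    apply: (coupling_compact_null cP).
      apply: compact_setX => //; apply: (subclosed_compact _ cQ1) => [|x []//].
      apply: closedI; last exact: open_closedC.
      by apply: compact_closed => //; exact: norm_hausdorff.
    move=> [x y] [[_ nVx] Dy] /KM[c c0 e]; apply: nVx.
    have [_] := DV _ Dy.
    have : projective_image M [set x] y by exists x => //; exists c.
    by rewrite imageE => -[_ /= ->].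
  have /(coupling_le cP) : snd @^-1` rboxes s `<=`
      fst @^-1` C `|` ((Q1 `\` V) `*` D `|` ~` (fst @^-1` Q1)).
    move=> e /= /sD De; have [Qe|] := pselect (Q1 e.1); last by right; right.
    by have [/VC|] := pselect (V e.1); [left|right; left].
  move=> /le_trans; apply; apply: (le_trans (couplingU cP _ _)).
  by rewrite (couplingU0 cP null Q10) addr0.
apply: measure_open_le => // s C cC sC CO.
have mO := open_measurable_plane oO.
have os := @open_rboxes R s.
have clC : closed C by apply: compact_closed => //; exact: norm_hausdorff.
suff : (nu (rboxes s) <= mu1 O)%E by [].
rewrite -nuE; last exact: open_measurable_plane.
apply: (le_trans (le_closed _ _ os clC sC)); apply: le_measure => //.
  by apply/mem_set; exact: closed_measurable_plane.
exact/mem_set.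
Qed.

End MeasureTransfer.

Theorem theorem4 (R : realType) (mu1 mu2 : probability (R * R)%type R)
    (compact_mu1 : compact (msupport mu1)) (compact_mu2 : compact (msupport mu2))
    (line_mu1 : forall L : set (R * R), is_line L -> mu1 L = 0%E)
    (line_mu2 : forall L : set (R * R), is_line L -> mu2 L = 0%E)
    (interior_mu1 : (msupport mu1)° !=set0)
    (interior_mu2 : (msupport mu2)° !=set0)
    (ell_eq : ell mu1 = ell mu2) :
  exists2 M : 'M[R]_3, M \in unitmx &
    forall A : set (R * R), measurable A ->
      mu2 (projective_image M A) = mu1 A.
Proof.
have [P cP] := exists_order_coupling line_mu1 line_mu2 ell_eq.
have cP' := order_coupling_swap cP.
have [V1 [Q1 [oV1 cQ1 VQ1 mV1]]] := compact_msupport_box compact_mu1.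
have [V2 [Q2 [oV2 cQ2 VQ2 mV2]]] := compact_msupport_box compact_mu2.
pose K := coupling_support P; pose U := (msupport mu1)°.
have oU : open U by exact: open_interior.
have K_area := coupling_support_area cP.
have K_fun x y y' : K (x, y) -> K (x, y') -> y = y' by exact: (coupling_support_fun cP line_mu1 interior_mu2).
(* The hypotheses are symmetric in the two measures, so injectivity is single-valuedness for the
   swapped coupling. *)
have K_inj x x' y : K (x, y) -> K (x', y) -> x = x'.
  move=> /coupling_support_swap Kx /coupling_support_swap Kx'.
  exact: (coupling_support_fun cP' line_mu2 interior_mu1 Kx Kx').
have /choice[f Kf] : forall x, exists y, U x -> K (x, y).
  move=> x; have [Ux|] := pselect (U x); last by exists x.
  have [y Kxy] := coupling_support_exists cP oV2 cQ2 VQ2 mV2 (interior_subset Ux).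
  by exists y.
have K_closed e : ~ K e -> \forall e' \near e, ~ K e'.
  exact: coupling_support_closed.
have K_bounded x y : K (x, y) -> Q2 y by exact: (coupling_support_snd cP oV2 cQ2 VQ2 mV2).
have f_cont x : U x -> f @ x --> f x.
  exact: (orientation_preserving_continuous K_closed cQ2 K_bounded K_fun oU Kf).
have f_coll x y z : U x -> U y -> U z -> area x y z = 0 -> area (f x) (f y) (f z) = 0.
  exact: (orientation_preserving_collinear K_area K_closed cQ2 K_bounded K_fun oU Kf).
have f_inj x y : U x -> U y -> f x = f y -> x = y.
  by move=> Ux Uy e; apply: (K_inj _ _ (f x)); [|rewrite e]; exact: Kf.
(* The swapped coupling has a support point over a box inside [U] whose other coordinate is off the
   [mu2]-null line [L]; by uniqueness that coordinate is a value of [f]. *)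
have f_nondeg (L : set (R * R)) : is_line L -> exists2 x, U x & ~ L (f x).
  move=> lL; have [p Up] := interior_mu1.
  have [q qp qU] := open_rbox_nbhs oU Up.
  have Sup_p : msupport mu1 p by exact: interior_subset Up.
  have nbq : nbhs p (closed_rbox q).
    by apply: filterS (@open_closed_rbox R q) _; apply: open_nbhs_nbhs; split=> //;
      exact: open_open_rbox.
  have [[y x] /= [Ke Cx nLy]] := coupling_support_avoid cP' (@compact_closed_rbox R q)
    (closed_line lL) (line_mu2 _ lL) (coupling_snd_support cP' Sup_p nbq).
  have Kxy : K (x, y).
    move=> N /(coupling_support_swap Ke); congr (0 < P _).
    by apply/seteqP; split=> -[].
  exists x; first exact: qU.
  by rewrite (K_fun _ _ _ (Kf _ (qU _ Cx)) Kxy).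
have [M [W [c [uM oW W0 WU HW]]]] :=
  locally_projective oU f_cont f_coll f_inj f_nondeg interior_mu1.
exists M => //.
apply: (coupling_projective_image cP line_mu2 cQ1 _ uM).
  have h : 1 <= P (fst @^-1` Q1).
    rewrite -lee_fin -mV1; apply: (le_trans (coupling_fst cP oV1)); rewrite lee_fin.
    by apply: (coupling_le cP) => e /=; exact: VQ1.
  have := couplingC cP (fst @^-1` Q1) => e.
  by apply/eqP; rewrite eq_le (coupling_ge0 cP) andbT; lra.
apply: (projective_of_local K_area oW W0 uM (f := f) (c := c)) => x Wx.
by have [c0 e] := HW x Wx; split=> //; apply: Kf; exact: WU.
Qed.
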